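(* Let $x : M \rightarrow \mathbb{E}^3$ be a connected surface in $\mathbb{E}^3$ (isometrically immersed). Then the Laplace transformation $\mathcal{L} : M \rightarrow L(M)$ of the surface is homothetic if and only if $M$ is an open portion of an ordinary sphere in $\mathbb{E}^3$.
   Context: Manifolds and immersions are smooth and connected. $\Delta=-\operatorname{trace}\nabla^2$ is the Laplace operator of $M$ with the induced metric. The Laplace map is $L:M\to\mathbb{E}^3$, $L(p)=(\Delta x)(p)$, equal to $-2H(p)$ where $H=\frac12\operatorname{trace}h$ is the mean curvature vector; the Laplace transformation $\mathcal L:M\to L(M)$ is $L$ regarded as a map onto its image. $\mathcal L$ is homothetic if there is a constant $c>0$ with $\langle dL(X),dL(Y)\rangle=c^2\langle X,Y\rangle$ for all tangent vectors $X,Y$ at a common point. An ordinary sphere may have any center and radius. *)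

(* Defs.v *)
(* Written with MathComp and MathComp-Analysis; the real line is an arbitrary
   R : realType. *)
From HB Require Import structures.
From mathcomp Require Import all_boot all_order all_algebra.
From mathcomp Require Import all_classical all_reals all_analysis.

Set Implicit Arguments.
Unset Strict Implicit.
Unset Printing Implicit Defensive.

Import Order.TTheory GRing.Theory Num.Theory.
Import numFieldNormedType.Exports.

Local Open Scope classical_set_scope.
Local Open Scope ring_scope.

(* The library norm on row vectors is the sup norm (it induces the usual
   topology and differentiability), so the Euclidean metric is given by dot. *)
Definition dot (R : realType) (n : nat) (u v : 'rV[R]_n) : R :=
  \sum_(i < n) u 0 i * v 0 i.

Fixpoint Ck_on (R : realType) (V W : normedModType R) (k : nat) (U : set V)
    (f : V -> W) : Prop :=
  match k with
  | 0%N => forall u, U u -> {for u, continuous f}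
  | k'.+1 => (forall u, U u -> differentiable f u) /\
             (forall v, Ck_on k' U ('D_v f))
  end.

(* Only meant for open U. *)
Definition smooth_on (R : realType) (V W : normedModType R) (U : set V)
  (f : V -> W) : Prop := forall k, Ck_on k U f.

(* A smooth atlas making M a 2-dimensional manifold: chart i is a
   homeomorphism from the open set dom i onto an open subset of the plane,
   with inverse param i.  Both maps are total; their values outside dom i and
   outside img i are irrelevant. *)
Record surface_atlas (R : realType) (M : topologicalType) := SurfaceAtlas {
  chart_index : Type ;
  dom : chart_index -> set M ;
  chart : chart_index -> M -> 'rV[R]_2 ;
  param : chart_index -> 'rV[R]_2 -> M ;
  dom_cover : forall p, exists i, dom i p ;
  dom_open : forall i, open (dom i) ;
  img_open : forall i, open (chart i @` dom i) ;
  chartK : forall i p, dom i p -> param i (chart i p) = p ;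
  chart_continuous : forall i p, dom i p -> {for p, continuous (chart i)} ;
  param_continuous : forall i u,
    (chart i @` dom i) u -> {for u, continuous (param i)} ;
  transition_smooth : forall i j,
    smooth_on (chart i @` (dom i `&` dom j)) (chart j \o param i)
}.

Section Surface.
Variables (R : realType) (M : topologicalType) (A : surface_atlas R M).

Definition img (i : chart_index A) : set 'rV[R]_2 := chart i @` dom i.

Definition chart_at (p : M) : chart_index A := projT1 (cid (dom_cover A p)).

Definition in_chart (T : Type) (i : chart_index A) (f : M -> T) :
  'rV[R]_2 -> T := f \o param i.

(* A tangent vector of M at p is represented, in any chart i around p, by its
   coordinates v : 'rV_2; this is the image of that vector by the differential
   of f at p. *)
Definition tangent_map (n : nat) (f : M -> 'rV[R]_n) (i : chart_index A)
  (p : M) (v : 'rV[R]_2) : 'rV[R]_n := 'D_v (in_chart i f) (chart i p).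

Definition smooth_map (n : nat) (f : M -> 'rV[R]_n) : Prop :=
  forall i, smooth_on (img i) (in_chart i f).

Definition immersion (n : nat) (x : M -> 'rV[R]_n) : Prop :=
  smooth_map x /\
  forall i p, dom i p -> injective (tangent_map x i p).

End Surface.

Section LocalRiemannian.
Variable R : realType.

Definition partial (W : normedModType R) (i : 'I_2) (f : 'rV[R]_2 -> W) :
  'rV[R]_2 -> W := 'D_(delta_mx 0 i) f.

Definition induced_metric (n : nat) (y : 'rV[R]_2 -> 'rV[R]_n)
  (u : 'rV[R]_2) : 'M[R]_2 :=
  \matrix_(i, j) dot (partial i y u) (partial j y u).

Variable g : 'rV[R]_2 -> 'M[R]_2.

(* Gamma^k_ij, the Levi-Civita connection of g. *)
Definition christoffel (k i j : 'I_2) (u : 'rV[R]_2) : R :=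
  2^-1 * \sum_(l < 2) invmx (g u) k l *
    (partial i (fun w => g w j l) u + partial j (fun w => g w i l) u
     - partial l (fun w => g w i j) u).

(* (nabla^2 f)_ij = d_i d_j f - sum_k Gamma^k_ij d_k f, componentwise on a
   vector-valued f. *)
Definition hessian (W : normedModType R) (f : 'rV[R]_2 -> W) (i j : 'I_2)
  (u : 'rV[R]_2) : W :=
  partial i (partial j f) u - \sum_(k < 2) christoffel k i j u *: partial k f u.

(* Minus the metric trace of the Hessian: nonnegative spectrum convention. *)
Definition laplacian (W : normedModType R) (f : 'rV[R]_2 -> W)
  (u : 'rV[R]_2) : W :=
  - \sum_(i < 2) \sum_(j < 2) invmx (g u) i j *: hessian f i j u.

End LocalRiemannian.

Section LaplaceMap.
Variables (R : realType) (M : topologicalType) (A : surface_atlas R M).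
Variables (n : nat) (x : M -> 'rV[R]_n).

(* The Laplace operator of M for the metric induced by x, computed at p in the
   chart chosen around p (its value does not depend on that choice). *)
Definition laplace_operator (m : nat) (f : M -> 'rV[R]_m) (p : M) : 'rV[R]_m :=
  let i := chart_at A p in
  laplacian (induced_metric (in_chart i x)) (in_chart i f) (chart i p).

Definition laplace_map : M -> 'rV[R]_n := laplace_operator x.

(* M carries the metric induced by the immersion x. *)
Definition homothetic (m : nat) (L : M -> 'rV[R]_m) : Prop :=
  exists2 c : R, 0 < c &
    forall (i : chart_index A) (p : M), dom i p ->
    forall X Y : 'rV[R]_2,
      dot (tangent_map L i p X) (tangent_map L i p Y) =
      c ^+ 2 * dot (tangent_map x i p X) (tangent_map x i p Y).

End LaplaceMap.

Definition round_sphere (R : realType) (n : nat) (a : 'rV[R]_n) (r : R) :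
  set 'rV[R]_n := [set y | dot (y - a) (y - a) = r ^+ 2].

(* x need not be injective: what is required is that its image be a relatively
   open subset of a sphere. *)
Definition open_portion_of_sphere (R : realType) (M : Type) (n : nat)
  (x : M -> 'rV[R]_n) : Prop :=
  exists (a : 'rV[R]_n) (r : R), 0 < r /\
  exists2 O : set 'rV[R]_n, open O & range x = O `&` round_sphere a r.

(* Main.v *)
(* On a sphere the Laplace map is x |-> (2 / r^2) (x - a).  Conversely, let the
   Laplace map be homothetic with ratio c, write y for the immersion in a chart
   and put z = L / c, so that z is normal to y, both y and z induce the metric g,
   and the trace of b_ij = <y_i, z_j> is c w, where w = |z|^2.  The isometry
   condition reads b g^-1 b + dw dw^T / (4 w) = g, and Cayley-Hamilton turns it
   into g - b = dw dw^T / (4 c w^2).  Hence q = y - z satisfies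
   <q_i, q_j> = w_i w_j / (2 c w^2): its differential is a multiple sg dw of dw.

   Suppose dw <> 0.  By symmetry of second derivatives d sg = sg' dw and
   d sg' = sg'' dw.  The scalar products of sg, sg' and z are explicit functions
   of w, and these three vectors are orthogonal to e = dy(v) = dz(v) <> 0, where v
   spans the kernel of dw.  So sg' is a combination of sg and z with coefficients
   depending on w only; differentiating this relation along v, which kills
   everything but z, forces 2 c w = 1, contradicting dw <> 0.

   Therefore dw = 0 and dq = 0: by connectedness y - z is a constant a and
   |y - a| = |z| is a constant r.  The image is relatively open in the sphere
   because, for Z on the sphere close to y(u), the distance to Z has an interior
   minimum on a small disc around u, where y - Z is normal. *)
Require Import Defs.
From HB Require Import structures.
From mathcomp Require Import all_boot all_order all_algebra.
From mathcomp Require Import all_classical all_reals all_analysis.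
From mathcomp Require Import ring lra.
Import Order.TTheory GRing.Theory Num.Theory.
Import numFieldNormedType.Exports.
Local Open Scope classical_set_scope.
Local Open Scope ring_scope.
Set Implicit Arguments.
Unset Strict Implicit.
Unset Printing Implicit Defensive.

(** * Smooth maps *)

Section SmoothCalculus.
Variables (R : realType) (V : normedModType R).
Implicit Types (U : set V) (f g : V -> R).

Lemma near_open_eq (T : Type) U (f g : V -> T) u :
  open U -> U u -> (forall w, U w -> f w = g w) -> \near u, f u = g u.
Proof.
move=> oU Uu fg; have := open_nbhs_nbhs (conj oU Uu).
by apply: filterS => w /fg.
Qed.

Lemma derive_open_eq (W : normedModType R) U (f g : V -> W) u v :
  open U -> U u -> (forall w, U w -> f w = g w) -> 'D_v f u = 'D_v g u.
Proof. by move=> oU Uu fg; apply/near_eq_derive/(near_open_eq oU Uu fg). Qed.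

Lemma differentiable_open_eq (W : normedModType R) U (f g : V -> W) u :
  open U -> U u -> (forall w, U w -> f w = g w) ->
  differentiable f u -> differentiable g u.
Proof.
move=> oU Uu fg /diff_locallyP [cf ef].
have fgu := fg u Uu.
(* The first-order expansion of [f] at [u] is also one of [g], with the same linear part; uniqueness
   of the differential then concludes. *)
have D : g \o shift u = cst (g u) + 'd f u +o_ 0 id.
  apply/eqaddoP => e e0; move/eqaddoP/(_ e e0): ef.
  have nU : \forall h \near (0 : V), U (h + u).
    have : \forall w \near u, U w by exact: open_nbhs_nbhs.
    by rewrite (near_shift 0 u) /= => H; apply: filterS H => h; rewrite subr0.
  by apply: filterS2 nU => h Uh; rewrite !fctE/= -fg // -fgu.
apply/diff_locallyP.
by rewrite (diff_unique cf D); split.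
Qed.

(** Functions are total, but only their values on [U] matter: since [U] is open, equality on [U]
    passes to directional derivatives and the induction goes through. *)
Lemma Ck_open_eq (W : normedModType R) k U (f g : V -> W) :
  open U -> (forall w, U w -> f w = g w) -> Ck_on k U f -> Ck_on k U g.
Proof.
move=> oU; elim: k f g => [|k IH] f g fg /=.
  move=> fc u Uu; rewrite /prop_for /continuous_at -fg //.
  apply: cvg_trans (fc u Uu); apply: near_eq_cvg.
  exact: near_open_eq oU Uu fg.
move=> [df Cf]; split=> [u Uu|v].
  exact: differentiable_open_eq fg (df u Uu).
by apply: IH (Cf v) => w Uw; exact: derive_open_eq fg.
Qed.

Lemma CkW (W : normedModType R) k U (f : V -> W) :
  Ck_on k.+1 U f -> Ck_on k U f.
Proof.
elim: k f => [|k IH] f /= [df Cf]; last by split=> // v; exact: IH.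
by move=> u Uu; exact: differentiable_continuous (df u Uu).
Qed.

Lemma Ck_cst (W : normedModType R) k U (c : W) : Ck_on k U (fun=> c).
Proof.
elim: k c => [|k IH] c /=; first by move=> u _; exact: cvg_cst.
split=> [u _|v]; first exact: differentiable_cst.
have -> : 'D_v (fun=> c) = fun=> (0 : W) by apply/funext => u; exact: derive_cst.
exact: IH.
Qed.

Lemma CkD (W : normedModType R) k U (f g : V -> W) : open U ->
  Ck_on k U f -> Ck_on k U g -> Ck_on k U (fun u => f u + g u).
Proof.
move=> oU; elim: k f g => [|k IH] f g /=.
  by move=> cf cg u Uu; apply: cvgD; [exact: cf|exact: cg].
move=> [df Cf] [dg Cg]; split=> [u Uu|v].
  by apply: differentiableD; [exact: df|exact: dg].
apply: Ck_open_eq oU _ (IH _ _ (Cf v) (Cg v)) => w Uw.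
by rewrite deriveD //; apply: diff_derivable; [exact: df|exact: dg].
Qed.

Lemma CkM k U f g : open U ->
  Ck_on k U f -> Ck_on k U g -> Ck_on k U (fun u => f u * g u).
Proof.
move=> oU; elim: k f g => [|k IH] f g.
  by move=> cf cg u Uu; apply: cvgM; [exact: cf|exact: cg].
move=> Cf Cg; have [df Cdf] := Cf; have [dg Cdg] := Cg; split=> [u Uu|v].
  by apply: differentiableM; [exact: df|exact: dg].
apply: Ck_open_eq oU _
  (CkD oU (IH _ _ (CkW Cf) (Cdg v)) (IH _ _ (CkW Cg) (Cdf v))) => w Uw.
by rewrite deriveM //; apply: diff_derivable; [exact: df|exact: dg].
Qed.

Lemma CkV k U f : open U -> (forall u, U u -> f u != 0) ->
  Ck_on k U f -> Ck_on k U (fun u => (f u)^-1).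
Proof.
move=> oU f0; elim: k => [|k IH].
  by move=> cf u Uu; apply: cvgV; [exact: f0|exact: cf].
move=> Cf; have [df Cdf] := Cf; split=> [u Uu|v].
  by apply: differentiableV; [exact: df|exact: f0].
(* D(1/f) = - (1/f)^2 D f, where 1/f is of class [k] by induction and D f by hypothesis. *)
have CI := IH (CkW Cf).
apply: Ck_open_eq oU _
  (CkM oU (Ck_cst k U (-1 : R)) (CkM oU (CkM oU CI CI) (Cdf v))) => w Uw.
rewrite deriveV //; [|exact: f0|by apply: diff_derivable; exact: df].
by rewrite -[RHS]/(_ * _) expr2 invfM mulN1r mulNr.
Qed.

Lemma Ck_rowP n k U (f : V -> 'rV[R]_n) : open U ->
  Ck_on k U f <-> forall i, Ck_on k U (fun u => f u 0 i).
Proof.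
move=> oU; elim: k f => [|k IH] f.
  split=> [cf i u Uu|cf u Uu].
    exact: (@cvg_comp _ _ _ f _ _ _ _ (cf u Uu) (@coord_continuous _ _ _ 0 i (f u))).
  apply/cvgrPdist_le => e e0.
  have : \forall w \near u, forall i, `|f u 0 i - f w 0 i| <= e.
    apply: filter_forall => i.
    exact: (cvgrPdist_le _ _).1 (cf i u Uu) e e0.
  apply: filterS => w Hw.
  rewrite /Num.Def.normr/= mx_normrE (bigmax_le _ (ltW e0))//= => -[a b] _.
  by rewrite !mxE/= (ord1 a).
split=> [[df Cf] i|Cf].
  split=> [u Uu|v].
    exact: (differentiable_comp (df u Uu) (differentiable_coord _ 0 i)).
  apply: Ck_open_eq oU _ ((IH _).1 (Cf v) i) => w Uw.
  by rewrite derive_mx ?mxE //; apply: diff_derivable; exact: df.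
have df u : U u -> differentiable f u.
  (* Differentiability is recovered from the coordinates by writing [f] as a finite sum of scalar
     functions times basis vectors. *)
  move=> Uu; have -> : f = \sum_j (fun w => f w 0 j *: delta_mx 0 j).
    apply/funext => w; rewrite fct_sumE.
    by apply/rowP => j; rewrite {1}(row_sum_delta (f w)).
  apply: differentiable_sum => j; apply: differentiableZl.
  by have [df _] := Cf j; exact: df.
split=> // v; apply/IH => i; have [_ Cfi] := Cf i.
apply: Ck_open_eq oU _ (Cfi v) => w Uw.
by rewrite derive_mx ?mxE //; apply: diff_derivable; exact: df.
Qed.

Lemma smoothP (W : normedModType R) U (f : V -> W) :
  smooth_on U f <->
  (forall u, U u -> differentiable f u) /\ forall v, smooth_on U ('D_v f).
Proof.
split=> [sf|[df sf] [|k]]; first by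
  split=> [|v k]; [case: (sf 1%N)|case: (sf k.+1) => _; exact].
  by move=> u Uu; exact: differentiable_continuous (df u Uu).
by split=> // v; exact: sf.
Qed.

Lemma smooth_diff (W : normedModType R) U (f : V -> W) u :
  smooth_on U f -> U u -> differentiable f u.
Proof. by move=> /smoothP[df _] Uu; exact: df. Qed.

Lemma smooth_derivable (W : normedModType R) U (f : V -> W) u v :
  smooth_on U f -> U u -> derivable f u v.
Proof. by move=> sf Uu; apply: diff_derivable; exact: smooth_diff Uu. Qed.

Lemma smooth_derive (W : normedModType R) U (f : V -> W) v :
  smooth_on U f -> smooth_on U ('D_v f).
Proof. by move=> /smoothP[]. Qed.

Lemma smooth_cst (W : normedModType R) U (c : W) : smooth_on U (fun=> c).
Proof. by move=> k; exact: Ck_cst. Qed.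

Lemma smoothM U f g : open U ->
  smooth_on U f -> smooth_on U g -> smooth_on U (fun u => f u * g u).
Proof. by move=> oU sf sg k; apply: CkM. Qed.

Lemma smoothV U f : open U -> (forall u, U u -> f u != 0) ->
  smooth_on U f -> smooth_on U (fun u => (f u)^-1).
Proof. by move=> oU f0 sf k; apply: CkV. Qed.

Lemma smoothD (W : normedModType R) U (f g : V -> W) : open U ->
  smooth_on U f -> smooth_on U g -> smooth_on U (fun u => f u + g u).
Proof. by move=> oU sf sg k; apply: CkD. Qed.

Lemma smooth_rowP n U (f : V -> 'rV[R]_n) : open U ->
  smooth_on U f <-> forall i, smooth_on U (fun u => f u 0 i).
Proof.
move=> oU; split=> [sf i k|sf k]; first exact: ((Ck_rowP _ _ oU).1 (sf k)).
by apply/Ck_rowP => // i; exact: sf.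
Qed.

Lemma smooth_sum U n (F : 'I_n -> V -> R) : open U ->
  (forall i, smooth_on U (F i)) -> smooth_on U (fun u => \sum_i F i u).
Proof.
move=> oU sF; elim: n F sF => [|n IH] F sF.
  have -> : (fun u => \sum_i F i u) = fun=> 0.
    by apply/funext => u; rewrite big_ord0.
  exact: smooth_cst.
have -> : (fun u => \sum_i F i u) =
    fun u => F ord0 u + \sum_i F (lift ord0 i) u.
  by apply/funext => u; rewrite big_ord_recl.
by apply: smoothD => //; apply: IH.
Qed.

Lemma smoothZ n U f (g : V -> 'rV[R]_n) : open U ->
  smooth_on U f -> smooth_on U g -> smooth_on U (fun u => f u *: g u).
Proof.
move=> oU sf /(smooth_rowP _ oU) sg; apply/smooth_rowP => // i.
rewrite (_ : (fun _ => _) = fun u => f u * g u 0 i).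
  exact: smoothM.
by apply/funext => u; rewrite mxE.
Qed.

Lemma smoothN n U (g : V -> 'rV[R]_n) : open U ->
  smooth_on U g -> smooth_on U (fun u => - g u).
Proof.
move=> oU sg; rewrite (_ : (fun _ => _) = fun u => (-1) *: g u).
  exact: smoothZ (smooth_cst _ _) sg.
by apply/funext => u; rewrite scaleN1r.
Qed.

Lemma smooth_sub_open (W : normedModType R) U U' (f : V -> W) :
  U' `<=` U -> smooth_on U f -> smooth_on U' f.
Proof.
move=> UU' sf k; elim: k f sf => [|k IH] f sf.
  by move=> u /UU'; exact: sf 0%N u.
by split=> [u /UU'|v]; [exact: smooth_diff|apply/IH/smooth_derive].
Qed.

Lemma smooth_open_eq (W : normedModType R) U (f g : V -> W) :
  open U -> (forall w, U w -> f w = g w) -> smooth_on U f -> smooth_on U g.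
Proof. by move=> oU fg sf k; exact: Ck_open_eq fg (sf k). Qed.

End SmoothCalculus.

(* Sealed copies of dot, partial and the two coordinate indices: left
   transparent, they make unification compute with derivatives and with 'I_2. *)
HB.lock Definition ip (R : realType) (n : nat) (u v : 'rV[R]_n) : R := dot u v.
HB.lock Definition pd (R : realType) (W : normedModType R) (i : 'I_2)
  (f : 'rV[R]_2 -> W) (u : 'rV[R]_2) : W := partial i f u.
HB.lock Definition i0 : 'I_2 := 0.
HB.lock Definition i1 : 'I_2 := 1.

(** * The Euclidean scalar product and its comparison with the sup norm *)

Section Dot.
Variables (R : realType) (n : nat).
Implicit Types u v w : 'rV[R]_n.

Lemma dotC u v : ip u v = ip v u.
Proof. by rewrite ip.unlock; apply: eq_bigr => i _; rewrite mulrC. Qed.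

Lemma dotDl u v w : ip (u + v) w = ip u w + ip v w.
Proof.
by rewrite ip.unlock -big_split; apply: eq_bigr => i _; rewrite mxE mulrDl. Qed.

Lemma dotZl k u w : ip (k *: u) w = k * ip u w.
Proof.
by rewrite ip.unlock mulr_sumr; apply: eq_bigr => i _; rewrite mxE mulrA. Qed.

Lemma dotDr u v w : ip w (u + v) = ip w u + ip w v.
Proof. by rewrite dotC dotDl !(dotC w). Qed.

Lemma dotZr k u w : ip w (k *: u) = k * ip w u.
Proof. by rewrite dotC dotZl (dotC w). Qed.

Lemma dotNl u w : ip (- u) w = - ip u w.
Proof. by rewrite -scaleN1r dotZl mulN1r. Qed.

Lemma dotNr u w : ip w (- u) = - ip w u.
Proof. by rewrite dotC dotNl dotC. Qed.

Lemma dotBl u v w : ip (u - v) w = ip u w - ip v w.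
Proof. by rewrite dotDl dotNl. Qed.

Lemma dotBr u v w : ip w (u - v) = ip w u - ip w v.
Proof. by rewrite dotDr dotNr. Qed.

Lemma dot0l w : ip 0 w = 0.
Proof. by rewrite -(scale0r 0) dotZl mul0r. Qed.

Lemma dot0r w : ip w 0 = 0.
Proof. by rewrite dotC dot0l. Qed.

Lemma dot_suml m (F : 'I_m -> 'rV[R]_n) w :
  ip (\sum_i F i) w = \sum_i ip (F i) w.
Proof.
by apply: (big_morph (fun u => ip u w)) => [u v|]; rewrite ?dotDl ?dot0l.
Qed.

Lemma dot_ge0 v : 0 <= ip v v.
Proof. by rewrite ip.unlock; apply: sumr_ge0 => i _; rewrite -expr2 sqr_ge0. Qed.

Lemma dot_eq0 v : ip v v = 0 -> v = 0.
Proof.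
rewrite ip.unlock => /eqP; rewrite psumr_eq0 => [|i _]; last by rewrite -expr2 sqr_ge0.
move=> /allP v0; apply/rowP => i; rewrite mxE; apply/eqP.
by have := v0 i (mem_index_enum i); rewrite mulf_eq0 orbb.
Qed.

Lemma dot_gt0 v : v != 0 -> 0 < ip v v.
Proof.
by move=> v0; rewrite lt0r dot_ge0 andbT; apply: contra_neq v0 => /dot_eq0.
Qed.

Definition dotE :=
  (dotDl, dotDr, dotNl, dotNr, dotZl, dotZr, dot0l, dot0r).

Lemma coord_le_norm v i : `|v 0 i| <= `|v|.
Proof.
by rewrite [leRHS]/Num.Def.normr/= mx_normrE; exact: (le_bigmax _ _ (0, i)).
Qed.

Lemma norm_le_coord v k : 0 <= k -> (forall i, `|v 0 i| <= k) -> `|v| <= k.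
Proof.
move=> k0 vk; rewrite [leLHS]/Num.Def.normr/= mx_normrE.
by apply: bigmax_le => //= -[a i] _ /=; rewrite (ord1 a).
Qed.

(** The norms are sup norms, whence the factor [n]. Together with [norm_sqr_le_dot] this lets
    Euclidean and sup norm estimates be exchanged. *)
Lemma dot_le_norm u v : `|ip u v| <= n%:R * (`|u| * `|v|).
Proof.
rewrite ip.unlock (le_trans (ler_norm_sum _ _ _)) //.
have -> : n%:R * (`|u| * `|v|) = \sum_(i < n) (`|u| * `|v|).
  by rewrite sumr_const card_ord mulr_natl.
by apply: ler_sum => i _; rewrite normrM ler_pM ?coord_le_norm.
Qed.

Lemma norm_sqr_le_dot v : `|v| ^+ 2 <= ip v v.
Proof.
have d0 := dot_ge0 v.
rewrite -(ler_sqrt _ d0) sqrtr_sqr normr_id.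
apply: norm_le_coord => [|i]; first exact: sqrtr_ge0.
rewrite -sqrtr_sqr ler_sqrt // ip.unlock /dot (bigD1 i) //= expr2 lerDl.
by apply: sumr_ge0 => j _; rewrite -expr2 sqr_ge0.
Qed.

End Dot.

(** * Differentiation of products, mean values and symmetry of second derivatives *)

Section Derivatives.
Variables (R : realType) (V : normedModType R).

Lemma derive_coord n (f : V -> 'rV[R]_n) u v i :
  derivable f u v -> 'D_v (fun w => f w 0 i) u = 'D_v f u 0 i.
Proof. by move=> df; rewrite derive_mx // mxE. Qed.

Lemma derivable_coord n (f : V -> 'rV[R]_n) u v i :
  derivable f u v -> derivable (fun w => f w 0 i) u v.
Proof. by move=> /derivable_mxP. Qed.

Lemma derive_mul (f g : V -> R) u v : derivable f u v -> derivable g u v ->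
  'D_v (fun w => f w * g w) u = 'D_v f u * g u + f u * 'D_v g u.
Proof.
move=> df dg; rewrite addrC [X in _ + X]mulrC.
exact: (@deriveM _ _ f g u v df dg).
Qed.

Lemma derivable_mul (f g : V -> R) u v : derivable f u v -> derivable g u v ->
  derivable (fun w => f w * g w) u v.
Proof. by move=> df dg; exact: (@derivableM _ _ f g u v df dg). Qed.

Lemma derive_dot n (f g : V -> 'rV[R]_n) u v :
  derivable f u v -> derivable g u v ->
  'D_v (fun w => ip (f w) (g w)) u =
    ip ('D_v f u) (g u) + ip (f u) ('D_v g u).
Proof.
move=> df dg.
have -> : (fun w => ip (f w) (g w)) =
    \sum_i (fun w => f w 0 i * g w 0 i).
  by apply/funext => w; rewrite ip.unlock fct_sumE.
rewrite derive_sum => [|i]; last by apply: derivable_mul; exact: derivable_coord.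
rewrite ip.unlock -big_split; apply: eq_bigr => i _.
by rewrite [LHS]derive_mul ?derive_coord //; exact: derivable_coord.
Qed.

Lemma derivable_scale n (k : V -> R) (g : V -> 'rV[R]_n) u v :
  derivable k u v -> derivable g u v -> derivable (fun w => k w *: g w) u v.
Proof.
move=> dk dg; apply/derivable_mxP => a i; rewrite (ord1 a).
rewrite (_ : (fun w => _) = fun w => k w * g w 0 i).
  by apply: derivable_mul; [exact: dk|exact: derivable_coord].
by apply/funext => w; rewrite mxE.
Qed.

Lemma derive_scale n (k : V -> R) (g : V -> 'rV[R]_n) u v :
  derivable k u v -> derivable g u v ->
  'D_v (fun w => k w *: g w) u = 'D_v k u *: g u + k u *: 'D_v g u.
Proof.
move=> dk dg; apply/rowP => i.
rewrite -derive_coord; last exact: derivable_scale.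
rewrite (_ : (fun w => _) = fun w => k w * g w 0 i).
  rewrite derive_mul; [|exact: dk|exact: derivable_coord].
  by rewrite derive_coord // !mxE.
by apply/funext => w; rewrite mxE.
Qed.

Lemma smooth_dot n (U : set V) (f g : V -> 'rV[R]_n) : open U ->
  smooth_on U f -> smooth_on U g -> smooth_on U (fun u => ip (f u) (g u)).
Proof.
move=> oU /(smooth_rowP _ oU) sf /(smooth_rowP _ oU) sg.
by rewrite ip.unlock; apply: smooth_sum => // i; apply: smoothM.
Qed.

Lemma is_derive_line (W : normedModType R) (f : V -> W) u v t :
  derivable f (u + t *: v) v ->
  is_derive t 1 (fun s : R => f (u + s *: v)) ('D_v f (u + t *: v)).
Proof.
have E : (fun h : R => h^-1 *: (((fun s : R => f (u + s *: v)) \o shift t)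
    (h *: 1) - f (u + t *: v))) =
    fun h => h^-1 *: ((f \o shift (u + t *: v)) (h *: v) - f (u + t *: v)).
  apply/funext => h; rewrite /= [h *: 1]mulr1 scalerDl.
  by congr (_ *: (f _ - _)); rewrite addrCA.
by move=> df; split; rewrite /derivable /derive E.
Qed.

Lemma is_derive_translate (W : normedModType R) (f : V -> W) u v b :
  derivable f (u + b) v ->
  is_derive u v (fun w => f (w + b)) ('D_v f (u + b)).
Proof.
have E : (fun h : R => h^-1 *: (((fun w => f (w + b)) \o shift u) (h *: v)
    - f (u + b))) = fun h => h^-1 *: ((f \o shift (u + b)) (h *: v) - f (u + b)).
  by apply/funext => h; rewrite /= addrA.
by move=> df; split; rewrite /derivable /derive E.
Qed.

Lemma MVT_line (f : V -> R) u v s : 0 <= s ->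
  (forall t, 0 <= t <= s -> differentiable f (u + t *: v)) ->
  exists2 t, 0 <= t <= s & f (u + s *: v) - f u = s * 'D_v f (u + t *: v).
Proof.
move=> s0 df.
have dfl t : 0 <= t <= s ->
    is_derive t 1 (fun s : R => f (u + s *: v)) ('D_v f (u + t *: v)).
  by move=> ts; apply: is_derive_line; apply: diff_derivable; exact: df.
have [|t||t ts] := @MVT_segment _ (fun s : R => f (u + s *: v))
    (fun t => 'D_v f (u + t *: v)) 0 s.
- exact: s0.
- by rewrite in_itv /= => /andP[t0 ts]; apply: dfl; rewrite !ltW.
- apply: derivable_within_continuous => t; rewrite in_itv /= => ts.
  by have [] := dfl t ts.
- rewrite scale0r addr0 subr0 mulrC => E; exists t => //.
Qed.

(** Two applications of the mean value theorem: along [a] to [g w = f (w + s b) - f w], then along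
    [b] to the derivative of [f] in direction [a]. *)
Lemma second_difference (U : set V) (f : V -> R) u a b s :
  smooth_on U f -> 0 <= s ->
  (forall t r, 0 <= t <= s -> 0 <= r <= s -> U (u + t *: a + r *: b)) ->
  exists2 tr : R * R, (0 <= tr.1 <= s) && (0 <= tr.2 <= s) &
    f (u + s *: a + s *: b) - f (u + s *: b) - (f (u + s *: a) - f u) =
    s * (s * 'D_b ('D_a f) (u + tr.1 *: a + tr.2 *: b)).
Proof.
move=> sf s0 HU.
have s00 : 0 <= (0 : R) <= s by rewrite lexx.
have s01 : 0 <= s <= s by rewrite s0 lexx.
pose g w := f (w + s *: b) - f w.
have dfs t r : 0 <= t <= s -> 0 <= r <= s ->
    differentiable f (u + t *: a + r *: b).
  by move=> ts rs; apply: smooth_diff sf _; exact: HU.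
have dfs0 t : 0 <= t <= s -> differentiable f (u + t *: a).
  by move=> ts; have := dfs t 0 ts s00; rewrite scale0r addr0.
have Dg t : 0 <= t <= s -> is_derive (u + t *: a) a g
    ('D_a f (u + t *: a + s *: b) - 'D_a f (u + t *: a)).
  move=> ts; apply: is_deriveB; last exact/derivableP/diff_derivable/dfs0.
  exact/is_derive_translate/diff_derivable/dfs.
have [t ts E1] : exists2 t, 0 <= t <= s &
    g (u + s *: a) - g u = s * 'D_a g (u + t *: a).
  have gl t : 0 <= t <= s -> is_derive t 1 (fun r : R => g (u + r *: a))
      ('D_a g (u + t *: a)).
    by move=> /Dg[dg _]; exact: is_derive_line.
  have [|t||t ts] := @MVT_segment _ (fun r : R => g (u + r *: a))
      (fun t => 'D_a g (u + t *: a)) 0 s.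
  - exact: s0.
  - by rewrite in_itv /= => /andP[t0 ts]; apply: gl; rewrite !ltW.
  - apply: derivable_within_continuous => t; rewrite in_itv /= => ts.
    by have [] := gl t ts.
  - rewrite scale0r addr0 subr0 mulrC => E; exists t => //.
have [r rs E2] := @MVT_line ('D_a f) (u + t *: a) b s s0
  (fun r rs => smooth_diff (smooth_derive a sf) (HU t r ts rs)).
exists (t, r); first by rewrite /= ts rs.
have := Dg t ts => Dgt.
rewrite /= -E2 -(@derive_val _ _ _ _ _ _ _ Dgt) -E1 /g.
ring.
Qed.

Lemma dist_half_contra (A B p q : R) :
  `|A - p| < `|A - B| / 2 -> `|B - q| < `|A - B| / 2 -> q = p -> False.
Proof.
move=> hA + qp; rewrite qp => hB.
suff : `|A - B| < `|A - B| / 2 + `|A - B| / 2 by rewrite -splitr ltxx.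
rewrite -{1}(subrKA p) (le_lt_trans (ler_normD _ _)) // ltrD //.
by rewrite distrC.
Qed.

(** Schwarz's theorem. The second difference is symmetric in [a] and [b], so one mixed derivative at
    some point near [u] equals the other at another such point; by continuity they cannot differ at
    [u]. *)
Lemma derive_comm (U : set V) (f : V -> R) u a b :
  open U -> U u -> smooth_on U f -> 'D_a ('D_b f) u = 'D_b ('D_a f) u.
Proof.
move=> oU Uu sf; apply/eqP; rewrite -subr_eq0; apply/negPn/negP => neq.
set e := `|'D_a ('D_b f) u - 'D_b ('D_a f) u|.
have e0 : 0 < e / 2 by rewrite divr_gt0 // normr_gt0.
have c1 : {for u, continuous ('D_a ('D_b f))}.
  exact: (smooth_derive a (smooth_derive b sf)) 0%N u Uu.
have c2 : {for u, continuous ('D_b ('D_a f))}.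
  exact: (smooth_derive b (smooth_derive a sf)) 0%N u Uu.
have : \forall w \near u, U w /\ (`|'D_a ('D_b f) u - 'D_a ('D_b f) w| < e / 2
    /\ `|'D_b ('D_a f) u - 'D_b ('D_a f) w| < e / 2).
  apply: filterI; first exact: open_nbhs_nbhs.
  apply: filterI.
    exact: (cvgrPdist_lt _ _).1 c1 _ e0.
  exact: (cvgrPdist_lt _ _).1 c2 _ e0.
move=> /nbhs_normP[d /= d0 Hd].
(* As [s K = d / 2], the parallelogram at [u] with sides [s a] and [s b] stays in the ball of radius
   [d]; the summand 1 keeps [K] positive when both directions vanish. *)
pose K := `|a| + `|b| + 1.
have K0 : 0 < K by rewrite ltr_wpDl // addr_ge0.
pose s := d / 2 / K.
have s0 : 0 < s by rewrite !divr_gt0.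
have small t r : 0 <= t <= s -> 0 <= r <= s ->
    `|u - (u + t *: a + r *: b)| < d.
  move=> /andP[t0 ts] /andP[r0 rs].
  rewrite -addrA opprD addrA subrr sub0r normrN.
  rewrite (le_lt_trans (ler_normD _ _)) // !normrZ !ger0_norm //.
  rewrite (@le_lt_trans _ _ (s * K)) //; last first.
    by rewrite /s divfK ?gt_eqF // ltr_pdivrMr // ltr_pMr // ltr1n.
  rewrite /K mulrDr mulrDr mulr1 -[leLHS]addr0 lerD //; last exact: ltW.
  by rewrite lerD // ler_wpM2r.
have Hsm t r ts rs := Hd _ (small t r ts rs).
have [[t r] /= /andP[ts rs] E1] := @second_difference U f u a b s sf (ltW s0)
  (fun t r ts rs => (Hsm t r ts rs).1).
have [[t' r'] /= /andP[ts' rs'] E2] := @second_difference U f u b a s sf (ltW s0)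
  (fun t r ts rs => (eq_ind _ U (Hsm r t rs ts).1 _ (addrAC _ _ _))).
have [_ [_ N1]] := Hsm t r ts rs.
have [_ [N2 _]] := Hsm r' t' rs' ts'.
have E : 'D_b ('D_a f) (u + t *: a + r *: b) =
    'D_a ('D_b f) (u + r' *: a + t' *: b).
  rewrite (addrAC u (s *: b)) in E2; rewrite (addrAC u (r' *: a)).
  have sn : s != 0 by rewrite gt_eqF.
  have key (A B p q c o : R) : p - q - (c - o) = s * (s * A) ->
      p - c - (q - o) = s * (s * B) -> A = B.
    by move=> h1 h2; apply/(mulfI sn)/(mulfI sn); rewrite -h1 -h2; ring.
  exact: key E1 E2.
exact: dist_half_contra N2 N1 E.
Qed.

End Derivatives.

Section Plane.
Variable R : realType.
Implicit Types (U : set 'rV[R]_2).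

Lemma sum2E (W : nmodType) (F : 'I_2 -> W) : \sum_(i < 2) F i = F i0 + F i1.
Proof.
rewrite big_ord_recl big_ord1; rewrite i0.unlock i1.unlock.
congr (_ + F _); exact: val_inj.
Qed.

Lemma sum3E (W : nmodType) (F : 'I_3 -> W) :
  \sum_(i < 3) F i = F 0 + F 1 + F 2%:R.
Proof.
rewrite !big_ord_recl big_ord0 addr0 addrA; congr (_ + F _ + F _);
  exact: val_inj.
Qed.

Lemma ord2P (P : 'I_2 -> Prop) : P i0 -> P i1 -> forall i, P i.
Proof.
rewrite i0.unlock i1.unlock => P0 P1 [[|[|//]] hi].
  by rewrite (_ : Ordinal _ = 0) //; exact: val_inj.
by rewrite (_ : Ordinal _ = 1) //; exact: val_inj.
Qed.

Lemma smooth_partial (W : normedModType R) U (f : 'rV[R]_2 -> W) i :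
  smooth_on U f -> smooth_on U (pd i f).
Proof. by rewrite pd.unlock; exact: smooth_derive. Qed.

Lemma derive_partialE (W : normedModType R) (f : 'rV[R]_2 -> W) u v :
  differentiable f u ->
  'D_v f u = v 0 i0 *: pd i0 f u + v 0 i1 *: pd i1 f u.
Proof.
move=> df; rewrite pd.unlock /partial !deriveE // -!linearZ -linearD; congr ('d f u _).
by rewrite {1}[v]row_sum_delta sum2E.
Qed.

Lemma partial_comm n U (f : 'rV[R]_2 -> 'rV[R]_n) u i j :
  open U -> U u -> smooth_on U f ->
  pd i (pd j f) u = pd j (pd i f) u.
Proof.
move=> oU Uu sf; rewrite pd.unlock.
have key a b k : partial a (partial b f) u 0 k =
    'D_(delta_mx 0 a) ('D_(delta_mx 0 b) (fun w => f w 0 k)) u.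
  rewrite /partial -derive_coord; last first.
    exact: smooth_derivable (smooth_derive _ sf) Uu.
  apply: (derive_open_eq _ oU Uu) => w Uw; rewrite derive_coord //.
  exact: smooth_derivable sf Uw.
apply/rowP => k; apply: (etrans (key i j k)); apply/esym.
apply: (etrans (key j i k)).
exact: derive_comm oU Uu ((smooth_rowP _ oU).1 sf k).
Qed.

Lemma partial_commR U (f : 'rV[R]_2 -> R) u i j :
  open U -> U u -> smooth_on U f -> pd i (pd j f) u = pd j (pd i f) u.
Proof. by rewrite pd.unlock; exact: derive_comm. Qed.

End Plane.

(** * Linear algebra in three-space *)

Section Space.
Variable R : realType.
Implicit Types u v n z : 'rV[R]_3.

(** The squared area of the parallelogram on [u] and [v]. Linear independence of two vectors is
    expressed throughout by its being nonzero. *)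
Definition gram u v : R := ip u u * ip v v - ip u v ^+ 2.

Lemma dot3E u v : ip u v = u 0 0 * v 0 0 + u 0 1 * v 0 1 + u 0 2%:R * v 0 2%:R.
Proof. by rewrite ip.unlock; exact: sum3E. Qed.

Lemma row3P u v : u 0 0 = v 0 0 -> u 0 1 = v 0 1 -> u 0 2%:R = v 0 2%:R -> u = v.
Proof.
move=> h0 h1 h2; apply/rowP => -[[|[|[|//]]] hi].
- by rewrite (_ : Ordinal hi = 0) //; exact: val_inj.
- by rewrite (_ : Ordinal hi = 1) //; exact: val_inj.
- by rewrite (_ : Ordinal hi = 2%:R) //; exact: val_inj.
Qed.

(* The vector product realizes the common normal direction of u and v, and
   its squared length is their Gram determinant (Lagrange's identity). *)
Lemma normal_line u v : exists c : 'rV[R]_3,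
  ip c c = gram u v /\
  forall z, ip z u = 0 -> ip z v = 0 -> gram u v *: z = ip z c *: c.
Proof.
pose c : 'rV[R]_3 := \row_(i < 3) [:: u 0 1 * v 0 2%:R - u 0 2%:R * v 0 1;
  u 0 2%:R * v 0 0 - u 0 0 * v 0 2%:R; u 0 0 * v 0 1 - u 0 1 * v 0 0]`_i.
have c0 : c 0 0 = u 0 1 * v 0 2%:R - u 0 2%:R * v 0 1 by rewrite mxE.
have c1 : c 0 1 = u 0 2%:R * v 0 0 - u 0 0 * v 0 2%:R by rewrite mxE.
have c2 : c 0 2%:R = u 0 0 * v 0 1 - u 0 1 * v 0 0 by rewrite mxE.
exists c; split; first by rewrite /gram !dot3E c0 c1 c2; ring.
move=> z; rewrite /gram !dot3E => zu zv.
(* [t] is the vector product of [z] and [c], by the triple product formula. The three identities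
   below say that [gram u v *: z - ip z c *: c] is the vector product of [c] and [t]. *)
pose t i := u 0 i * (z 0 0 * v 0 0 + z 0 1 * v 0 1 + z 0 2%:R * v 0 2%:R)
  - v 0 i * (z 0 0 * u 0 0 + z 0 1 * u 0 1 + z 0 2%:R * u 0 2%:R).
have t0 i : t i = 0 by rewrite /t zu zv !mulr0 subrr.
apply: row3P; rewrite [LHS]mxE [RHS]mxE !c0 !c1 !c2; apply: subr0_eq.
- transitivity (c 0 1 * t 2%:R - c 0 2%:R * t 1); last by rewrite !t0; ring.
  by rewrite /t c1 c2; ring.
- transitivity (c 0 2%:R * t 0 - c 0 0 * t 2%:R); last by rewrite !t0; ring.
  by rewrite /t c0 c2; ring.
- transitivity (c 0 0 * t 1 - c 0 1 * t 0); last by rewrite !t0; ring.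
  by rewrite /t c0 c1; ring.
Qed.

Lemma gram_ge0 u v : 0 <= gram u v.
Proof. by have [c [<- _]] := normal_line u v; exact: dot_ge0. Qed.

Lemma normal_parallel u v z z' : gram u v != 0 ->
  ip z u = 0 -> ip z v = 0 -> ip z' u = 0 -> ip z' v = 0 -> gram z z' = 0.
Proof.
move=> g0 zu zv zu' zv'; have [c [_ cP]] := normal_line u v.
have E x : ip x u = 0 -> ip x v = 0 -> x = (ip x c / gram u v) *: c.
  by move=> xu xv; rewrite mulrC -scalerA -cP // scalerK.
by rewrite (E z) // (E z') // /gram !dotE; ring.
Qed.

(** Both [z] and [n] lie on the normal line, so their Gram determinant vanishes; as they are
    orthogonal, it is also |z|^2 |n|^2. *)
Lemma basis3 u v n z : gram u v != 0 -> ip n u = 0 -> ip n v = 0 -> n != 0 ->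
  ip z u = 0 -> ip z v = 0 -> ip z n = 0 -> z = 0.
Proof.
move=> g0 nu nv n0 zu zv zn; apply: dot_eq0.
have := normal_parallel g0 zu zv nu nv; rewrite /gram zn expr0n subr0.
by move=> /eqP; rewrite mulf_eq0 (gt_eqF (dot_gt0 n0)) orbF => /eqP.
Qed.

(** Expansion in the frame [u], [v], [n] with denominators cleared: the tangential part goes through
    the inverse Gram matrix, the normal part through |n|^2. *)
Lemma dot_basis3 u v n a b : gram u v != 0 ->
  ip n u = 0 -> ip n v = 0 -> n != 0 ->
  gram u v * ip n n * ip a b =
    ip n n * (ip v v * (ip a u * ip b u)
      - ip u v * (ip a u * ip b v + ip a v * ip b u)
      + ip u u * (ip a v * ip b v)) + gram u v * (ip a n * ip b n).
Proof.
move=> g0 nu nv n0.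
(* The frame expansion of [a] times the common denominator: the difference of both sides is
   orthogonal to [u], [v] and [n]. *)
have /(congr1 (fun q => ip q b)) : gram u v * ip n n *: a
  - (ip n n *: ((ip v v * ip a u - ip u v * ip a v) *: u
      + (ip u u * ip a v - ip u v * ip a u) *: v)
    + gram u v * ip a n *: n) = 0.
  apply: (basis3 g0 nu nv n0); rewrite !dotE ?nu ?nv ?(dotC u n) ?(dotC v n)
    ?nu ?nv ?(dotC v u) /gram; ring.
rewrite !dotE !(dotC _ b) => /subr0_eq ->; ring.
Qed.

End Space.

(** * Solving for the second fundamental form in terms of the metric and the gradient of [w] *)

Section ShapeAlgebra.
Variable R : realType.

(* With w = |z|^2, d = grad w, b_ij = <y_i, z_j> and g the common metric of y
   and z, the hypotheses say, in terms of the operator beta = g^-1 b, that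
   beta^2 + g^-1 d d^T / (4w) = 1 and tr beta = c w.  Cayley-Hamilton and the
   determinant give (1 + det beta)^2 = (tr beta)^2, whence the formula for b. *)
Lemma shape_solve (g11 g12 g22 b11 b12 b22 d1 d2 w c : R) :
  let D := g11 * g22 - g12 ^+ 2 in
  0 < D -> 0 <= g11 -> 0 <= g22 -> 0 < w -> 0 < c ->
  g22 * b11 - 2 * g12 * b12 + g11 * b22 = c * w * D ->
  4 * w * (g22 * (b11 * b11) - g12 * (b11 * b12 + b12 * b11)
     + g11 * (b12 * b12)) + D * (d1 * d1) = 4 * w * D * g11 ->
  4 * w * (g22 * (b11 * b12) - g12 * (b11 * b22 + b12 * b12)
     + g11 * (b12 * b22)) + D * (d1 * d2) = 4 * w * D * g12 ->
  4 * w * (g22 * (b12 * b12) - g12 * (b12 * b22 + b22 * b12)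
     + g11 * (b22 * b22)) + D * (d2 * d2) = 4 * w * D * g22 ->
  [/\ 4 * c * w ^+ 2 * (g11 - b11) = d1 * d1,
      4 * c * w ^+ 2 * (g12 - b12) = d1 * d2 &
      4 * c * w ^+ 2 * (g22 - b22) = d2 * d2].
Proof.
move=> D D0 g110 g220 w0 c0 tr e11 e12 e22.
pose dl := (b11 * b22 - b12 ^+ 2) / D.
have Dn : D != 0 by rewrite gt_eqF.
have dlD : b11 * b22 - b12 ^+ 2 = dl * D by rewrite divfK.
(* b g^-1 b = tau b - delta g *)
have step gi bij bg dij : 4 * w * bij + D * dij = 4 * w * D * gi ->
    (g22 * b11 - 2 * g12 * b12 + g11 * b22) * bg -
      (b11 * b22 - b12 ^+ 2) * gi = bij ->
    4 * w * (c * w * bg - dl * gi) + dij = 4 * w * gi.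
  rewrite tr dlD => E F; apply: (mulfI Dn).
  transitivity (4 * w * D * gi); last by ring.
  by rewrite -E -F; ring.
have f11 : 4 * w * (c * w * b11 - dl * g11) + d1 * d1 = 4 * w * g11.
  by apply: step e11 _; ring.
have f12 : 4 * w * (c * w * b12 - dl * g12) + d1 * d2 = 4 * w * g12.
  by apply: step e12 _; ring.
have f22 : 4 * w * (c * w * b22 - dl * g22) + d2 * d2 = 4 * w * g22.
  by apply: step e22 _; ring.
(* [E / D] is the squared length of the gradient for [g], and [dl] is det beta. [E] is computed
   twice, from tr beta^2 and from the trace of the Cayley-Hamilton form. *)
pose E := g22 * (d1 * d1) - 2 * g12 * (d1 * d2) + g11 * (d2 * d2).
have wn : w != 0 by rewrite gt_eqF.
have detE : E = 4 * w * D * (1 - dl ^+ 2).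
  set p11 := g22 * _ - _ + _ in e11; set p12 := g22 * _ - _ + _ in e12.
  set p22 := g22 * _ - _ + _ in e22.
  have q11 : D * (d1 * d1) = 4 * w * (D * g11 - p11).
    by apply/eqP; rewrite -subr_eq0 -(subrr (4 * w * D * g11)) -{1}e11;
      apply/eqP; ring.
  have q12 : D * (d1 * d2) = 4 * w * (D * g12 - p12).
    by apply/eqP; rewrite -subr_eq0 -(subrr (4 * w * D * g12)) -{1}e12;
      apply/eqP; ring.
  have q22 : D * (d2 * d2) = 4 * w * (D * g22 - p22).
    by apply/eqP; rewrite -subr_eq0 -(subrr (4 * w * D * g22)) -{1}e22;
      apply/eqP; ring.
  pose S := g22 * p11 - 2 * g12 * p12 + g11 * p22.
  have DE : D * E = 4 * w * (2 * D ^+ 2 - S).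
    transitivity (g22 * (D * (d1 * d1)) - 2 * g12 * (D * (d1 * d2))
      + g11 * (D * (d2 * d2))); first by rewrite /E; ring.
    by rewrite q11 q12 q22 /S /D; ring.
  (* [S] is D^2 tr beta^2. Since 1 - beta^2 has rank at most one, det (1 - beta^2) = 0, that is, tr
     beta^2 = 1 + (det beta)^2. *)
  have hS : S = D ^+ 2 * (1 + dl ^+ 2).
    have n0 : 16 * w ^+ 2 * D != 0 by rewrite !mulf_neq0 ?expf_neq0.
    apply: (mulfI n0); apply/esym; apply: subr0_eq.
    transitivity ((D * (d1 * d1)) * (D * (d2 * d2)) - (D * (d1 * d2)) ^+ 2);
      last by ring.
    rewrite q11 q12 q22; transitivity (16 * w ^+ 2 * D *
      (D ^+ 2 - S + (dl * D) ^+ 2)); first by ring.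
    by rewrite -dlD /S /p11 /p12 /p22 /D; ring.
  by apply: (mulfI Dn); rewrite DE hS; ring.
have trE : E = 4 * w * D * (2 - (c * w) ^+ 2 + 2 * dl).
  have h : g22 * (4 * w * (c * w * b11 - dl * g11) + d1 * d1)
    - 2 * g12 * (4 * w * (c * w * b12 - dl * g12) + d1 * d2)
    + g11 * (4 * w * (c * w * b22 - dl * g22) + d2 * d2) = 8 * w * D.
    by rewrite f11 f12 f22 /D; ring.
  apply: subr0_eq; move/eqP: h; rewrite -subr_eq0 => /eqP <-.
  transitivity (E - 4 * w * (2 * D + 2 * D * dl - (c * w) * (c * w * D))).
    by ring.
  by rewrite -tr /E /D; ring.
have dlE : (c * w) ^+ 2 = (1 + dl) ^+ 2.
  have n0 : 4 * w * D != 0 by rewrite !mulf_neq0.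
  by apply: (mulfI n0); move: trE; rewrite detE => h; nra.
have E0 : 0 <= E.
  have g11_gt0 : 0 < g11.
    rewrite lt0r g110 andbT; apply: contraL D0 => /eqP g0.
    by rewrite /D g0 mul0r sub0r oppr_gt0 -leNgt sqr_ge0.
  rewrite -(pmulr_rge0 _ g11_gt0).
  have -> : g11 * E = (g11 * d2 - g12 * d1) ^+ 2 + D * d1 ^+ 2.
    by rewrite /E /D; ring.
  by rewrite addr_ge0 ?sqr_ge0 // mulr_ge0 ?sqr_ge0 // ltW.
(* [E >= 0] means [dl ^+ 2 <= 1], which selects the root [c * w = 1 + dl]. *)
have dl1 : 0 <= 1 + dl.
  have : 0 <= 1 - dl ^+ 2.
    by rewrite -(pmulr_rge0 _ (_ : 0 < 4 * w * D)) -?detE // !mulr_gt0.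
  by nra.
have dlc : dl = c * w - 1.
  have : c * w = 1 + dl.
    by apply/eqP; rewrite -(eqrXn2 (n := 2)) ?dlE // ltW // mulr_gt0.
  by move=> ->; rewrite addrAC subrr add0r.
split.
- by move: f11; rewrite dlc => h; nra.
- by move: f12; rewrite dlc => h; nra.
- by move: f22; rewrite dlc => h; nra.
Qed.

End ShapeAlgebra.

(** * Partial derivatives on plane domains, and maps whose partials are proportional to those of a
    function *)

Section PlaneCalculus.
Variables (R : realType) (U : set 'rV[R]_2).
Hypothesis oU : open U.
Implicit Types (u v : 'rV[R]_2) (i j : 'I_2).

Lemma partial_dot n (f g : 'rV[R]_2 -> 'rV[R]_n) i u :
  smooth_on U f -> smooth_on U g -> U u ->
  pd i (fun t => ip (f t) (g t)) u =
    ip (pd i f u) (g u) + ip (f u) (pd i g u).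
Proof.
by rewrite pd.unlock => sf sg Uu; apply: derive_dot; [exact: smooth_derivable sf Uu|
  exact: smooth_derivable sg Uu].
Qed.

Lemma partial_scale n (k : 'rV[R]_2 -> R) (g : 'rV[R]_2 -> 'rV[R]_n) i u :
  smooth_on U k -> smooth_on U g -> U u ->
  pd i (fun t => k t *: g t) u =
    pd i k u *: g u + k u *: pd i g u.
Proof.
by rewrite pd.unlock => sf sg Uu; apply: derive_scale; [exact: smooth_derivable sf Uu|
  exact: smooth_derivable sg Uu].
Qed.

Lemma partial_sub n (f g : 'rV[R]_2 -> 'rV[R]_n) i u :
  smooth_on U f -> smooth_on U g -> U u ->
  pd i (fun t => f t - g t) u = pd i f u - pd i g u.
Proof.
rewrite pd.unlock => sf sg Uu.
exact: (@deriveB _ _ _ f g u _ (smooth_derivable sf Uu)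
  (smooth_derivable sg Uu)).
Qed.

Lemma partial_open_eq (W : normedModType R) (f g : 'rV[R]_2 -> W) i u :
  U u -> (forall t, U t -> f t = g t) -> pd i f u = pd i g u.
Proof. by rewrite pd.unlock => Uu fg; exact: derive_open_eq fg. Qed.

Lemma partial_cst (W : normedModType R) (f : 'rV[R]_2 -> W) (k : W) i u :
  U u -> (forall t, U t -> f t = k) -> pd i f u = 0.
Proof.
move=> Uu fk; rewrite (partial_open_eq i Uu (g := fun=> k)) //.
by rewrite pd.unlock; exact: derive_cst.
Qed.

(** Either of [d0] and [d1] may vanish, so the common factor is obtained by projecting on the
    direction (d0, d1); its denominator stays nonzero and it depends smoothly on the data. *)
Lemma parallel_quotient (n : nat) (d0 d1 : R) (a b : 'rV[R]_n) :
  d0 ^+ 2 + d1 ^+ 2 != 0 -> d1 *: a = d0 *: b ->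
  let s := (d0 ^+ 2 + d1 ^+ 2)^-1 *: (d0 *: a + d1 *: b) in
  a = d0 *: s /\ b = d1 *: s.
Proof.
move=> d0n E s; split; apply: (scalerI d0n);
  rewrite /s 2!scalerA mulrAC mulfV // mul1r scalerDr scalerDl.
  by rewrite !scalerA (mulrC d0 d1) -(scalerA d1 d0) -E scalerA !expr2.
by rewrite !scalerA (mulrC d1 d0) -(scalerA d0 d1) E scalerA !expr2.
Qed.

(* If all partials of f are multiples of those of w, then f is locally a
   function of w, and sg is its derivative with respect to w. *)
Lemma parallel_factor n (w : 'rV[R]_2 -> R) (f : 'rV[R]_2 -> 'rV[R]_n) :
  smooth_on U w -> smooth_on U f ->
  (forall u, U u -> pd i0 w u ^+ 2 + pd i1 w u ^+ 2 != 0) ->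
  (forall u, U u -> pd i1 w u *: pd i0 f u =
    pd i0 w u *: pd i1 f u) ->
  exists2 sg : 'rV[R]_2 -> 'rV[R]_n, smooth_on U sg &
    forall i u, U u -> pd i f u = pd i w u *: sg u.
Proof.
move=> sw sf w0 par.
have sd i : smooth_on U (pd i w) by exact: smooth_partial.
exists (fun u => (pd i0 w u ^+ 2 + pd i1 w u ^+ 2)^-1
  *: (pd i0 w u *: pd i0 f u + pd i1 w u *: pd i1 f u)).
  apply: smoothZ => //.
    apply: smoothV; first exact: oU.
      exact: w0.
    apply: smoothD; first exact: oU.
      exact: (smoothM oU (sd i0) (sd i0)).
    exact: (smoothM oU (sd i1) (sd i1)).
  by apply: smoothD => //; apply: smoothZ => //; exact: smooth_partial.
move=> i u Uu; have := parallel_quotient (w0 u Uu) (par u Uu).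
by move=> [h0 h1]; move: i; apply: ord2P; [exact: h0|exact: h1].
Qed.

(** Differentiating f_i = w_i sg and using f_ij = f_ji and w_ij = w_ji leaves w_i sg_j = w_j sg_i,
    so [parallel_factor] applies to [sg]. *)
Lemma parallel_derivative n (w : 'rV[R]_2 -> R) (f sg : 'rV[R]_2 -> 'rV[R]_n) :
  smooth_on U w -> smooth_on U f -> smooth_on U sg ->
  (forall u, U u -> pd i0 w u ^+ 2 + pd i1 w u ^+ 2 != 0) ->
  (forall i u, U u -> pd i f u = pd i w u *: sg u) ->
  exists2 sg' : 'rV[R]_2 -> 'rV[R]_n, smooth_on U sg' &
    forall i u, U u -> pd i sg u = pd i w u *: sg' u.
Proof.
move=> sw sf ssg w0 fsg; apply: (parallel_factor sw ssg w0) => u Uu.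
have dd i j : pd j (pd i f) u =
    pd j (pd i w) u *: sg u + pd i w u *: pd j sg u.
  rewrite -(partial_scale _ (smooth_partial i sw) ssg Uu).
  by apply: (partial_open_eq _ Uu) => t Ut; exact: fsg.
have := partial_comm i0 i1 oU Uu sf; rewrite !dd.
have <- : pd i1 (pd i0 w) u = pd i0 (pd i1 w) u.
  exact: partial_commR oU Uu sw.
by move=> /addrI.
Qed.

Lemma smooth_neq0_open (f : 'rV[R]_2 -> R) :
  smooth_on U f -> open [set u | U u /\ f u != 0].
Proof.
move=> sf; rewrite openE => u [Uu fu].
have cf : {for u, continuous f} by exact: (sf 0%N u Uu).
have nf : \forall t \near u, f t != 0 by exact: cvgr_neq0 cf fu.
by apply: filterI; [exact: open_nbhs_nbhs|exact: nf].
Qed.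

End PlaneCalculus.

(** * Normal isometric companions of an immersion *)

Definition sq_norm (R : realType) n (z : 'rV[R]_2 -> 'rV[R]_n) u := ip (z u) (z u).

(** For [y] twice this is the first fundamental form; for [y] and a normal field [z] it is, up to
    sign, the second fundamental form in the direction [z]. *)
Definition mixed_metric (R : realType) n (y z : 'rV[R]_2 -> 'rV[R]_n) i j u :=
  ip (pd i y u) (pd j z u).

(* z is the Laplace map divided by the homothety ratio c. *)
Record laplace_isometric (R : realType) (U : set 'rV[R]_2)
    (y z : 'rV[R]_2 -> 'rV[R]_3) (c : R) : Prop := LaplaceIsometric {
  li_open : open U ;
  li_smooth : smooth_on U y ;
  li_smooth_normal : smooth_on U z ;
  li_gt0 : 0 < c ;
  li_immersion : forall u, U u -> gram (pd i0 y u) (pd i1 y u) != 0 ;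
  li_normal : forall i u, U u -> ip (z u) (pd i y u) = 0 ;
  li_isometric : forall i j u, U u ->
    mixed_metric z z i j u = mixed_metric y y i j u ;
  li_trace : forall u, U u ->
    mixed_metric y y i1 i1 u * mixed_metric y z i0 i0 u
      - 2 * mixed_metric y y i0 i1 u * mixed_metric y z i0 i1 u
      + mixed_metric y y i0 i0 u * mixed_metric y z i1 i1 u =
    c * sq_norm z u * gram (pd i0 y u) (pd i1 y u)
}.

(** Passes from the expansion of [dot_basis3] to the form required by [shape_solve]; [p] and [q]
    stand for half the partials of [w]. *)
Lemma shape_rescale (F : comRingType) (G W gae g00 g01 g11 b0a b0e b1a b1e p q : F) :
  G * W * gae = W * (g11 * (b0a * b0e) - g01 * (b0a * b1e + b1a * b0e)
    + g00 * (b1a * b1e)) + G * (p * q) ->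
  4 * W * (g11 * (b0a * b0e) - g01 * (b0a * b1e + b1a * b0e)
    + g00 * (b1a * b1e)) + G * (2 * p * (2 * q)) = 4 * W * G * gae.
Proof. by move=> h; transitivity (4 * (G * W * gae)); [rewrite h|]; ring. Qed.

Section Rigidity.
Variables (R : realType) (U : set 'rV[R]_2) (y z : 'rV[R]_2 -> 'rV[R]_3) (c : R).
Hypothesis yz : laplace_isometric U y z c.

Local Notation w := (sq_norm z).
Local Notation g := (mixed_metric y y).
Local Notation b := (mixed_metric y z).

Let oU := li_open yz.
Let sy := li_smooth yz.
Let sz := li_smooth_normal yz.
Let c_gt0 := li_gt0 yz.

Lemma z_normal i u : U u -> ip (z u) (pd i y u) = 0.
Proof. exact: li_normal yz i u. Qed.

Lemma z_isom i j u : U u ->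
  ip (pd i z u) (pd j z u) = g i j u.
Proof. exact: li_isometric yz i j u. Qed.

Lemma y_imm u : U u -> gram (pd i0 y u) (pd i1 y u) != 0.
Proof. exact: li_immersion yz u. Qed.

Lemma gC i j u : g i j u = g j i u.
Proof. exact: dotC. Qed.

Lemma smooth_w : smooth_on U w.
Proof. exact: (smooth_dot oU sz sz). Qed.

Lemma partial_w i u : U u -> pd i w u = 2 * ip (pd i z u) (z u).
Proof.
move=> Uu; rewrite (partial_dot _ sz sz Uu) (dotC (z u)).
by rewrite mulr2n mulrDl mul1r.
Qed.

(** The derivative of <z, y_i> = 0 in direction [j]. Symmetry of [b] follows from that of second
    derivatives. *)
Lemma bE i j u : U u -> b i j u = - ip (z u) (pd j (pd i y) u).
Proof.
move=> Uu; have := partial_dot j sz (smooth_partial i sy) Uu.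
rewrite (partial_cst oU j Uu (k := 0)); last by move=> t Ut; exact: z_normal.
by move/esym/eqP; rewrite addr_eq0 dotC => /eqP.
Qed.

Lemma bC i j u : U u -> b i j u = b j i u.
Proof.
by move=> Uu; rewrite (bE i j Uu) (bE j i Uu) (partial_comm j i oU Uu sy).
Qed.

Lemma z_gram u : U u ->
  gram (pd i0 z u) (pd i1 z u) = gram (pd i0 y u) (pd i1 y u).
Proof.
move=> Uu; rewrite /gram (z_isom i0 i0 Uu) (z_isom i0 i1 Uu) (z_isom i1 i1 Uu).
reflexivity.
Qed.

(* Where z vanishes so does b, hence both partials of z lie on the normal line
   and cannot be independent. *)
Lemma w_gt0 u : U u -> 0 < w u.
Proof.
move=> Uu; apply: dot_gt0; apply: contraNneq (y_imm Uu) => z0.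
have zy i j : ip (pd i z u) (pd j y u) = 0.
  by rewrite dotC -/(b j i u) (bE j i Uu) z0 dot0l oppr0.
rewrite -(z_gram Uu).
  by apply/eqP; apply: (normal_parallel (y_imm Uu)); exact: zy.
Qed.

Lemma w_neq0 u : U u -> w u != 0.
Proof. by move=> Uu; rewrite gt_eqF // w_gt0. Qed.

Lemma c_neq0 : c != 0.
Proof. by rewrite gt_eqF. Qed.

Lemma z_neq0 u : U u -> z u != 0.
Proof.
move=> Uu; apply: contraTneq (w_gt0 Uu) => z0.
by rewrite /w z0 dot0l ltxx.
Qed.

(** The isometry condition <z_i, z_j> = g_ij, expanded in the frame y_0, y_1, z, and the trace
    condition are the input of [shape_solve]. *)
Lemma shape i j u : U u ->
  4 * c * w u ^+ 2 * (g i j u - b i j u) = pd i w u * pd j w u.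
Proof.
move=> Uu.
have G0 : 0 < gram (pd i0 y u) (pd i1 y u).
  by rewrite lt0r y_imm //= gram_ge0.
have key a e : 4 * w u * (g i1 i1 u * (b i0 a u * b i0 e u)
    - g i0 i1 u * (b i0 a u * b i1 e u + b i1 a u * b i0 e u)
    + g i0 i0 u * (b i1 a u * b i1 e u)) +
    gram (pd i0 y u) (pd i1 y u) * (pd a w u * pd e w u) =
    4 * w u * gram (pd i0 y u) (pd i1 y u) * g a e u.
  have := dot_basis3 (pd a z u) (pd e z u) (y_imm Uu)
    (z_normal i0 Uu) (z_normal i1 Uu) (z_neq0 Uu).
  rewrite (partial_w a Uu) (partial_w e Uu) (z_isom a e Uu).
  rewrite (dotC (pd a z u) (pd i0 y u)).
  rewrite (dotC (pd a z u) (pd i1 y u)).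
  rewrite (dotC (pd e z u) (pd i0 y u)).
  rewrite (dotC (pd e z u) (pd i1 y u)).
  exact: shape_rescale.
have g0 a : 0 <= g a a u by exact: dot_ge0.
have b10 := bC i1 i0 Uu.
have e00 := key i0 i0; have e01 := key i0 i1; have e11 := key i1 i1.
rewrite b10 in e00 e01 e11.
have [s00 s01 s11] := shape_solve G0 (g0 i0) (g0 i1) (w_gt0 Uu) c_gt0
  (li_trace yz Uu) e00 e01 e11.
move: i j; apply: ord2P; apply: ord2P => //.
by rewrite b10 gC mulrC (mulrC (pd i1 w u)) -s01 mulrC.
Qed.

Let q u := y u - z u.

Lemma smooth_q : smooth_on U q.
Proof. by apply: smoothD => //; exact: smoothN. Qed.

Lemma partial_q i u : U u -> pd i q u = pd i y u - pd i z u.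
Proof. exact: partial_sub. Qed.

Lemma dot_q_y i j u : U u ->
  ip (pd i q u) (pd j y u) = g i j u - b i j u.
Proof. by move=> Uu; rewrite partial_q // dotBl (dotC (pd i z u)) -/(b j i u) bC. Qed.

Lemma dot_q_z i j u : U u ->
  ip (pd i q u) (pd j z u) = - (g i j u - b i j u).
Proof. by move=> Uu; rewrite partial_q // dotBl z_isom // opprB. Qed.

Lemma dot_q_q i j u : U u ->
  ip (pd i q u) (pd j q u) = 2 * (g i j u - b i j u).
Proof.
move=> Uu; rewrite [X in ip _ X](partial_q j Uu) dotBr.
rewrite (dot_q_y i j Uu) (dot_q_z i j Uu) opprK.
by rewrite mulr2n mulrDl mul1r.
Qed.

Lemma q_metric i j u : U u ->
  2 * c * w u ^+ 2 * ip (pd i q u) (pd j q u) =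
    pd i w u * pd j w u.
Proof. by move=> Uu; rewrite (dot_q_q i j Uu) -(shape i j Uu); ring. Qed.

Lemma cw2_neq0 u : U u -> 2 * c * w u ^+ 2 != 0.
Proof.
by move=> Uu; rewrite !mulf_neq0 ?expf_neq0 ?c_neq0 ?(w_neq0 Uu) ?pnatr_eq0.
Qed.

(** By [q_metric] the Gram matrix of the partials of [q] is a multiple of dw dw^T, so the difference
    of the two sides has length zero. *)
Lemma q_parallel u : U u ->
  pd i1 w u *: pd i0 q u = pd i0 w u *: pd i1 q u.
Proof.
move=> Uu; apply: subr0_eq; apply: dot_eq0.
apply: (mulfI (cw2_neq0 Uu)); rewrite mulr0 !dotE.
rewrite (dotC (pd i1 q u) (pd i0 q u)).
have h00 := q_metric i0 i0 Uu; have h01 := q_metric i0 i1 Uu.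
have h11 := q_metric i1 i1 Uu.
transitivity (pd i1 w u ^+ 2 * (2 * c * w u ^+ 2 * ip (pd i0 q u) (pd i0 q u))
  - 2 * pd i0 w u * pd i1 w u * (2 * c * w u ^+ 2 * ip (pd i0 q u) (pd i1 q u))
  + pd i0 w u ^+ 2 * (2 * c * w u ^+ 2 * ip (pd i1 q u) (pd i1 q u))).
  by ring.
by rewrite h00 h01 h11; ring.
Qed.

Lemma q_stationary i u : U u -> pd i w u = 0 -> pd i q u = 0.
Proof.
move=> Uu d0; apply: dot_eq0; apply: (mulfI (cw2_neq0 Uu)).
by rewrite (q_metric i i Uu) d0 !mulr0.
Qed.

(** * The contradictory case: the gradient of [w] vanishes nowhere on [U] *)

Section NonStationary.
Hypothesis w_regular : forall u, U u ->
  pd i0 w u ^+ 2 + pd i1 w u ^+ 2 != 0.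

(** The scalar identities below arise multiplied by w_i^2 for each [i]; summing over [i] leaves the
    nonzero factor |dw|^2. *)
Lemma regular_cancel u x : U u ->
  (forall i, pd i w u * (pd i w u * x) = 0) -> x = 0.
Proof.
move=> Uu h; apply: (mulfI (w_regular Uu)).
rewrite mulr0 mulrDl !expr2 -!mulrA.
by rewrite (h i0) (h i1) addr0.
Qed.

Variables sg sg' sg'' : 'rV[R]_2 -> 'rV[R]_3.
Hypotheses (ssg : smooth_on U sg) (ssg' : smooth_on U sg').
Hypothesis chain : forall i u, U u -> [/\ pd i q u = pd i w u *: sg u,
  pd i sg u = pd i w u *: sg' u &
  pd i sg' u = pd i w u *: sg'' u].

Lemma q_sg i u : U u -> pd i q u = pd i w u *: sg u.
Proof. by case/(chain i). Qed.

Lemma sg_sg' i u : U u -> pd i sg u = pd i w u *: sg' u.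
Proof. by case/(chain i). Qed.

Lemma sg'_sg'' i u : U u -> pd i sg' u = pd i w u *: sg'' u.
Proof. by case/(chain i). Qed.

(** As y_i is tangent, <q_i, z> = - <z_i, z> = - w_i / 2. *)
Lemma sg_z u : U u -> ip (sg u) (z u) = - 2^-1.
Proof.
move=> Uu; apply: subr0_eq; apply: (regular_cancel Uu) => i.
rewrite [X in _ * X](_ : _ = 0) ?mulr0 // opprK mulrDr -dotZl -q_sg //.
rewrite partial_q // dotBl dotC z_normal // sub0r (partial_w i Uu).
by rewrite mulrAC mulfV ?pnatr_eq0 // mul1r addNr.
Qed.

Lemma sg_sg u : U u -> 2 * c * w u ^+ 2 * ip (sg u) (sg u) = 1.
Proof.
move=> Uu; apply: subr0_eq; apply: (regular_cancel Uu) => i.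
have := q_metric i i Uu; rewrite q_sg // dotZl dotZr.
move: (ip _ _) (pd i w u) (2 * c * w u ^+ 2) => s d k h.
by transitivity (k * (d * (d * s)) - d * d); [ring|rewrite h subrr].
Qed.

(** Differentiating [sg_z] gives w_i <sg', z> = - <sg, z_i>, and w_i <sg, z_i> = <q_i, z_i> is known
    from [shape]. *)
Lemma sg'_z u : U u -> 4 * c * w u ^+ 2 * ip (sg' u) (z u) = 1.
Proof.
move=> Uu; apply: subr0_eq; apply: (regular_cancel Uu) => i.
have := partial_dot i ssg sz Uu.
rewrite (partial_cst oU i Uu (k := (- 2^-1 : R))) => [|t Ut]; last exact: sg_z.
rewrite sg_sg' // dotZl => /esym/eqP; rewrite addr_eq0 => /eqP h.
have := dot_q_z i i Uu; rewrite q_sg // dotZl => h2.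
have := shape i i Uu; rewrite -[g i i u - b i i u]opprK -h2.
move=> h3.
transitivity (pd i w u * (4 * c * w u ^+ 2 * (pd i w u * ip (sg' u) (z u)))
  - pd i w u * pd i w u); first by ring.
by rewrite h -h3; ring.
Qed.

(** Obtained by differentiating |w sg|^2 = 1 / (2 c), a form of [sg_sg] with constant right-hand
    side. *)
Lemma sg'_sg u : U u -> 2 * c * w u ^+ 3 * ip (sg' u) (sg u) = -1.
Proof.
move=> Uu; apply: subr0_eq; apply: (regular_cancel Uu) => i.
have swsg : smooth_on U (fun t => w t *: sg t).
  exact: smoothZ oU smooth_w ssg.
have cn : 2 * c != 0 by rewrite mulf_neq0 ?c_neq0 ?pnatr_eq0.
have := partial_dot i swsg swsg Uu.
rewrite (partial_cst oU i Uu (k := (2 * c)^-1)) => [|t Ut]; last first.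
  apply: (mulfI cn); rewrite mulfV // dotZl dotZr.
  by apply: (etrans _ (sg_sg Ut)); ring.
rewrite (partial_scale i smooth_w ssg Uu) sg_sg' // !dotE (dotC (sg u) (sg' u)).
have := sg_sg Uu.
move=> h1 h2.
transitivity (pd i w u * (pd i w u * (2 * c * w u ^+ 3 * ip (sg' u) (sg u) +
  2 * c * w u ^+ 2 * ip (sg u) (sg u)))); first by rewrite h1 opprK.
by rewrite -[RHS](mulr0 (c * w u * pd i w u)) h2; ring.
Qed.

(* A tangent vector along which w is stationary; y and z have the same, nonzero,
   derivative along it, whereas sg and sg' are stationary. *)
Let v u : 'rV[R]_2 :=
  (- pd i1 w u) *: delta_mx 0 i0 + pd i0 w u *: delta_mx 0 i1.

Lemma derive_v (W : normedModType R) (f : 'rV[R]_2 -> W) u :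
  smooth_on U f -> U u ->
  'D_(v u) f u = (- pd i1 w u) *: pd i0 f u +
                 pd i0 w u *: pd i1 f u.
Proof.
move=> sf Uu; rewrite (derive_partialE (v u) (smooth_diff sf Uu)).
have i01 : (i0 == i1) = false by rewrite i0.unlock i1.unlock.
by congr (_ *: _ + _ *: _); rewrite !mxE !eqxx ?i01 1?eq_sym ?i01 /=
  ?mulr0 ?mulr1 ?addr0 ?add0r.
Qed.

Lemma derive_v_multiple n (f h : 'rV[R]_2 -> 'rV[R]_n) u :
  smooth_on U f -> U u ->
  (forall i, pd i f u = pd i w u *: h u) -> 'D_(v u) f u = 0.
Proof.
move=> sf Uu fh; rewrite derive_v // !fh !scalerA -scalerDl mulrC.
by rewrite mulrN addNr scale0r.
Qed.

Lemma derive_v_w u : U u -> 'D_(v u) w u = 0.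
Proof.
move=> Uu; rewrite (derive_v smooth_w Uu).
have E (a e : R) : - a * e + e * a = 0 by ring.
exact: E.
Qed.

Let e u := 'D_(v u) y u.

(** The partials of [q] are multiples of those of [w], so [q = y - z] is stationary along [v]. *)
Lemma derive_v_z u : U u -> 'D_(v u) z u = e u.
Proof.
move=> Uu; have := derive_v_multiple smooth_q Uu (fun i => q_sg i Uu).
rewrite [X in X = _ -> _](_ : _ = e u - 'D_(v u) z u) => [/subr0_eq //|].
exact: (@deriveB _ _ _ y z u _ (smooth_derivable sy Uu) (smooth_derivable sz Uu)).
Qed.

Lemma e_z u : U u -> ip (e u) (z u) = 0.
Proof.
by move=> Uu; rewrite dotC /e derive_v // dotDr !dotZr !z_normal // !mulr0 addr0.
Qed.

(** w_i <e, sg> = <e, q_i> is the contraction of g - b with [v]; by [shape] it is proportional to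
    w_i dw(v) = 0. *)
Lemma e_sg u : U u -> ip (e u) (sg u) = 0.
Proof.
move=> Uu; apply: (regular_cancel Uu) => i.
rewrite -[X in _ * X]dotZr -q_sg // /e derive_v //.
rewrite (dotC _ (pd i q u)) dotDr !dotZr !dot_q_y //.
apply: (mulfI (_ : 4 * c * w u ^+ 2 != 0)).
  by rewrite !mulf_neq0 ?expf_neq0 ?c_neq0 ?(w_neq0 Uu) ?pnatr_eq0.
have h0 := shape i i0 Uu; have h1 := shape i i1 Uu.
transitivity (pd i w u * (pd i0 w u * (4 * c * w u ^+ 2 * (g i i1 u - b i i1 u))
  - pd i1 w u * (4 * c * w u ^+ 2 * (g i i0 u - b i i0 u)))); first by ring.
by rewrite h0 h1; ring.
Qed.

Lemma derive_v_cst (W : normedModType R) (f : 'rV[R]_2 -> W) k u :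
  U u -> (forall t, U t -> f t = k) -> 'D_(v u) f u = 0.
Proof.
move=> Uu fk; rewrite (derive_open_eq (v u) oU Uu (g := fun=> k)) //.
exact: derive_cst.
Qed.

(** Differentiating the constant <w z, w sg'> = 1 / (4 c) along [v] leaves only w^2 <e, sg'>. *)
Lemma e_sg' u : U u -> ip (e u) (sg' u) = 0.
Proof.
move=> Uu; have cn : 4 * c != 0 by rewrite mulf_neq0 ?c_neq0 ?pnatr_eq0.
have swz : smooth_on U (fun t => w t *: z t) by exact: smoothZ oU smooth_w sz.
have swsg' : smooth_on U (fun t => w t *: sg' t).
  exact: smoothZ oU smooth_w ssg'.
have dw (f : 'rV[R]_2 -> 'rV[R]_3) : smooth_on U f ->
    'D_(v u) (fun t => w t *: f t) u = w u *: 'D_(v u) f u.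
  move=> sf; rewrite derive_scale; [|exact: smooth_derivable smooth_w Uu|
    exact: smooth_derivable sf Uu].
  by rewrite derive_v_w // scale0r add0r.
have := derive_dot (smooth_derivable swz Uu) (smooth_derivable swsg' Uu).
move=> /(_ (v u)).
rewrite (dw _ sz) (dw _ ssg') derive_v_z //.
rewrite (derive_v_multiple ssg' Uu (fun i => sg'_sg'' i Uu)) scaler0 dot0r addr0.
rewrite dotZl dotZr.
rewrite (derive_v_cst Uu (k := (4 * c)^-1)) => [|t Ut].
  by move/esym/eqP; rewrite !mulf_eq0 (gt_eqF (w_gt0 Uu)) /= => /eqP.
apply: (mulfI cn); rewrite mulfV // dotZl dotZr (dotC (z t)).
by apply: (etrans _ (sg'_z Ut)); ring.
Qed.

Lemma e_neq0 u : U u -> e u != 0.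
Proof.
move=> Uu; apply: contraNneq (w_regular Uu) => e0.
have E : pd i0 w u *: pd i1 y u = pd i1 w u *: pd i0 y u.
  apply: subr0_eq; rewrite -[RHS]e0 /e derive_v // scaleNr addrC //.
have h0 := congr1 (fun t => ip t (pd i0 y u)) E.
have h1 := congr1 (fun t => ip t (pd i1 y u)) E.
rewrite !dotZl in h0 h1; apply/eqP.
have := y_imm Uu; rewrite /gram => G0.
apply: (mulfI G0); rewrite mulr0.
rewrite (dotC (pd i1 y u) (pd i0 y u)) in h0.
move/eqP: h0; rewrite -subr_eq0 => /eqP h0.
move/eqP: h1; rewrite -subr_eq0 => /eqP h1.
set F := ip (pd i0 y u) (pd i1 y u) in h0 h1 *.
set E0 := ip (pd i0 y u) (pd i0 y u) in h0 h1 *.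
set G := ip (pd i1 y u) (pd i1 y u) in h0 h1 *.
set d0 := pd i0 w u in h0 h1 *; set d1 := pd i1 w u in h0 h1 *.
(* This is the Gram determinant times |dw|^2, regrouped so that each product contains a factor that
   vanishes by [h0] or [h1]. *)
transitivity ((d0 * E0 + d1 * F) * (d0 * G - d1 * F) -
  (d0 * F + d1 * G) * (d0 * F - d1 * E0)); first by ring.
by rewrite h0 h1 !mulr0 subrr.
Qed.

(** If [sg] and [z] were dependent, [sg_z] would give w sg = - z / 2, so [sg] would be normal; then
    <q_i, y_i> = 0 and [shape] gives w_i = 0. *)
Lemma sg_z_gram u : U u -> gram (sg u) (z u) != 0.
Proof.
move=> Uu; apply: contraNneq (w_regular Uu) => G0; apply/eqP.
have wsg : w u *: sg u = - 2^-1 *: z u.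
  apply: subr0_eq; apply: dot_eq0; rewrite !dotE (dotC (z u) (sg u)) (sg_z Uu).
  transitivity (w u * gram (sg u) (z u)); last by rewrite G0 mulr0.
  by rewrite /gram (sg_z Uu) -/(w u); ring.
have h i : pd i w u = 0.
  apply/eqP; rewrite -sqrf_eq0 expr2 -(shape i i Uu) -(dot_q_y i i Uu) (q_sg i Uu).
  rewrite (_ : _ * _ = 4 * c * w u * pd i w u * ip (w u *: sg u) (pd i y u)).
    by rewrite wsg dotZl (z_normal i Uu) !mulr0.
  by rewrite !dotE; ring.
by rewrite (h i0) (h i1) expr0n addr0.
Qed.

(* The derivative sg' lies in the span of sg and z. *)
Lemma sg'_span u : U u ->
  (w u * (w u * (w u * (4 * c + - (2 * c ^+ 2) * w u)))) *: sg' u +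
  (w u * (w u * (3 * c))) *: sg u + (- 1 + 2 * c * w u) *: z u = 0.
Proof.
move=> Uu; have wn := w_neq0 Uu.
have h1 := sg_z Uu; have h2 := sg_sg Uu; have h3 := sg'_z Uu.
have h4 := sg'_sg Uu.
(* The coefficients solve, up to a common factor, the two linear equations obtained by pairing with
   [sg] and [z]; all three vectors are orthogonal to [e], which completes the frame. *)
apply: (basis3 (sg_z_gram Uu) (e_sg Uu) (e_z Uu) (e_neq0 Uu)).
- rewrite !dotE (dotC (z u) (sg u)) h1.
  transitivity ((2 - c * w u) * (2 * c * w u ^+ 3 * ip (sg' u) (sg u)) +
    3 / 2 * (2 * c * w u ^+ 2 * ip (sg u) (sg u)) + (-1 + 2 * c * w u) * - 2^-1).
    by field.
  by rewrite h4 h2; field.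
- rewrite !dotE h1 -/(w u).
  transitivity ((w u - 2^-1 * c * w u ^+ 2) * (4 * c * w u ^+ 2 * ip (sg' u) (z u))
    + w u * (w u * (3 * c)) * - 2^-1 + (-1 + 2 * c * w u) * w u).
    by field.
  by rewrite h3; field.
- by rewrite !dotE !(dotC _ (e u)) (e_sg Uu) (e_z Uu) (e_sg' Uu); ring.
Qed.

(** Smoothness is bundled in so that the notion is closed under sums and products: polynomials in
    [w] then behave as constants under differentiation along [v]. *)
Definition stationary u (f : 'rV[R]_2 -> R) := smooth_on U f /\ 'D_(v u) f u = 0.

Lemma stationary_cst u k : stationary u (fun=> k).
Proof. by split; [exact: smooth_cst|exact: derive_cst]. Qed.

Lemma stationaryM u f h : U u ->
  stationary u f -> stationary u h -> stationary u (fun t => f t * h t).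
Proof.
move=> Uu [sf f0] [sh h0]; split; first exact: smoothM.
rewrite (derive_mul (smooth_derivable sf Uu) (smooth_derivable sh Uu)).
by rewrite f0 h0 mul0r mulr0 addr0.
Qed.

Lemma stationaryD u f h : U u ->
  stationary u f -> stationary u h -> stationary u (fun t => f t + h t).
Proof.
move=> Uu [sf f0] [sh h0]; split; first exact: smoothD.
have := @deriveD _ _ _ f h u (v u) (smooth_derivable sf Uu) (smooth_derivable sh Uu).
by rewrite f0 h0 addr0.
Qed.

Lemma stationaryZ u f (h : 'rV[R]_2 -> 'rV[R]_3) : U u ->
  stationary u f -> smooth_on U h ->
  'D_(v u) (fun t => f t *: h t) u = f u *: 'D_(v u) h u.
Proof.
move=> Uu [sf f0] sh.
rewrite (derive_scale (smooth_derivable sf Uu) (smooth_derivable sh Uu)).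
by rewrite f0 scale0r add0r.
Qed.

Lemma w_forced u : U u -> w u = (2 * c)^-1.
Proof.
move=> Uu.
have Sw : stationary u w by split; [exact: smooth_w|exact: derive_v_w].
have cst := stationary_cst u.
have SA : stationary u
    (fun t => w t * (w t * (w t * (4 * c + - (2 * c ^+ 2) * w t)))).
  apply: (stationaryM Uu Sw); apply: (stationaryM Uu Sw).
  apply: (stationaryM Uu Sw); apply: (stationaryD Uu (cst (4 * c))).
  exact: (stationaryM Uu (cst (- (2 * c ^+ 2))) Sw).
have SB : stationary u (fun t => w t * (w t * (3 * c))).
  apply: (stationaryM Uu Sw); exact: (stationaryM Uu Sw (cst (3 * c))).
have SC : stationary u (fun t => - 1 + 2 * c * w t).
  apply: (stationaryD Uu (cst (- 1))).
  exact: (stationaryM Uu (cst (2 * c)) Sw).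
have sA := smoothZ oU SA.1 ssg'; have sB := smoothZ oU SB.1 ssg.
have sC := smoothZ oU SC.1 sz; have sAB := smoothD oU sA sB.
have := derive_v_cst Uu sg'_span.
have D1 := @deriveD _ _ _ _ _ u (v u) (smooth_derivable sAB Uu)
  (smooth_derivable sC Uu).
have D2 := @deriveD _ _ _ _ _ u (v u) (smooth_derivable sA Uu)
  (smooth_derivable sB Uu).
move=> D0; have := etrans (esym D0) D1; rewrite D2.
rewrite (stationaryZ Uu SA ssg') (stationaryZ Uu SB ssg) (stationaryZ Uu SC sz).
rewrite (derive_v_z Uu) (derive_v_multiple ssg' Uu (fun i => sg'_sg'' i Uu)).
rewrite (derive_v_multiple ssg Uu (fun i => sg_sg' i Uu)) !scaler0 !add0r.
(* What survives is (- 1 + 2 c w) e = 0. *)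
move/esym/eqP; rewrite scaler_eq0 (negbTE (e_neq0 Uu)) orbF addrC subr_eq0.
move/eqP => h; apply: (mulfI (_ : 2 * c != 0)).
  by rewrite mulf_neq0 ?c_neq0 ?pnatr_eq0.
by rewrite h mulfV // mulf_neq0 ?c_neq0 ?pnatr_eq0.
Qed.

Lemma chain_false u : U u -> False.
Proof.
move=> Uu; have := w_regular Uu.
by rewrite !(partial_cst oU _ Uu w_forced) expr0n addr0 eqxx.
Qed.

End NonStationary.

Lemma regular_false u :
  (forall u, U u -> pd i0 w u ^+ 2 + pd i1 w u ^+ 2 != 0) -> U u -> False.
Proof.
move=> wr.
have [sg ssg h1] := parallel_factor oU smooth_w smooth_q wr q_parallel.
have [sg' ssg' h2] := parallel_derivative oU smooth_w smooth_q ssg wr h1.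
have [sg'' ssg'' h3] := parallel_derivative oU smooth_w ssg ssg' wr h2.
by apply: (chain_false wr ssg ssg') => i t Ut; split; [exact: h1|exact: h2|exact: h3].
Qed.

End Rigidity.

Lemma laplace_isometric_sub (R : realType) (U U' : set 'rV[R]_2) y z c :
  open U' -> U' `<=` U -> laplace_isometric U y z c -> laplace_isometric U' y z c.
Proof.
move=> oU' UU' H; split => //; [exact: smooth_sub_open UU' (li_smooth H)|
  exact: smooth_sub_open UU' (li_smooth_normal H)|exact: li_gt0 H|..].
- by move=> u /UU'; exact: li_immersion H u.
- by move=> i u /UU'; exact: li_normal H i u.
- by move=> i j u /UU'; exact: li_isometric H i j u.
- by move=> u /UU'; exact: li_trace H u.
Qed.

Lemma laplace_isometric_rigid (R : realType) (U : set 'rV[R]_2) y z c i u :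
  laplace_isometric U y z c -> U u ->
  pd i (sq_norm z) u = 0 /\ pd i (fun t => y t - z t) u = 0.
Proof.
move=> H Uu; set w := sq_norm z.
have sw := smooth_w H; have sd j : smooth_on U (pd j w) by exact: smooth_partial.
suff h j : pd j w u = 0 by split; [exact: h|exact: (q_stationary H Uu (h i))].
have oU := li_open H.
(* [r] is |dw|^2. On the open set where it is nonzero [regular_false] applies, so that set is
   empty. *)
pose r t := pd i0 w t * pd i0 w t + pd i1 w t * pd i1 w t.
have sr : smooth_on U r by apply: smoothD => //; exact: smoothM.
have oU' := smooth_neq0_open oU sr.
have r0 : r u = 0.
  apply/eqP/negPn/negP => rn.
  apply: (regular_false (laplace_isometric_sub oU' _ H) _ (conj Uu rn)).
    by move=> t [].
  by move=> t []; rewrite !expr2.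
move: j; apply: ord2P; apply/eqP; move: r0 => /eqP;
  by rewrite paddr_eq0 -?expr2 ?sqr_ge0 // !sqrf_eq0 => /andP[].
Qed.

(** * The Laplacian in a chart *)

Section Matrix22.
Variable F : comUnitRingType.
Implicit Type A : 'M[F]_2.

Lemma invmx22E A i j : A \in unitmx ->
  invmx A i j = (\det A)^-1 * ((-1) ^+ (j + i) * A (lift j ord0) (lift i ord0)).
Proof. by move=> uA; rewrite /invmx uA !mxE /cofactor det_mx11 !mxE. Qed.

Lemma det22E A : \det A = A i0 i0 * A i1 i1 - A i0 i1 * A i1 i0.
Proof.
rewrite (expand_det_row _ i0) sum2E /cofactor !det_mx11 !mxE.
have l0 : lift i0 ord0 = i1 by rewrite i0.unlock i1.unlock; exact: val_inj.
have l1 : lift i1 ord0 = i0 by rewrite i0.unlock i1.unlock; exact: val_inj.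
rewrite l0 l1 i0.unlock i1.unlock /= expr0 mul1r expr1; ring.
Qed.

Lemma inv22_sum A (B : 'I_2 -> 'I_2 -> F) : A \in unitmx ->
  \sum_i \sum_j invmx A i j * B i j =
  (\det A)^-1 * (A i1 i1 * B i0 i0 - A i0 i1 * B i0 i1 - A i1 i0 * B i1 i0
    + A i0 i0 * B i1 i1).
Proof.
move=> uA; rewrite !sum2E !invmx22E //.
have l0 : lift i0 ord0 = i1 by rewrite i0.unlock i1.unlock; exact: val_inj.
have l1 : lift i1 ord0 = i0 by rewrite i0.unlock i1.unlock; exact: val_inj.
rewrite l0 l1.
have -> : (-1 : F) ^+ (i0 + i0) = 1 by rewrite i0.unlock.
have -> : (-1 : F) ^+ (i1 + i1) = 1 by rewrite i1.unlock /= sqrrN expr1n.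
have -> : (-1 : F) ^+ (i0 + i1) = -1 by rewrite i0.unlock i1.unlock.
have -> : (-1 : F) ^+ (i1 + i0) = -1 by rewrite i0.unlock i1.unlock.
ring.
Qed.

End Matrix22.

Section Laplacian.
Variables (R : realType) (U : set 'rV[R]_2) (y : 'rV[R]_2 -> 'rV[R]_3).
Hypotheses (oU : open U) (sy : smooth_on U y).
Hypothesis y_imm : forall u, U u -> gram (pd i0 y u) (pd i1 y u) != 0.

Local Notation G := (induced_metric y).
Local Notation lap := (laplacian G y).

Lemma induced_metricE i j u : G u i j = ip (pd i y u) (pd j y u).
Proof. by rewrite mxE ip.unlock pd.unlock. Qed.

Lemma det_induced_metric u : \det (G u) = gram (pd i0 y u) (pd i1 y u).
Proof. by rewrite det22E !induced_metricE /gram expr2 (dotC (pd i1 y u)). Qed.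

Lemma induced_metric_unit u : U u -> G u \in unitmx.
Proof. by move=> Uu; rewrite unitmxE unitfE det_induced_metric y_imm. Qed.

Lemma smooth_metric i j : smooth_on U (fun t => G t i j).
Proof.
rewrite (_ : (fun _ => _) = fun t => ip (pd i y t) (pd j y t)).
  by apply: smooth_dot => //; exact: smooth_partial.
by apply/funext => t; rewrite induced_metricE.
Qed.

Lemma pd_metric i j k u : U u -> pd k (fun t => G t i j) u =
  ip (pd k (pd i y) u) (pd j y u) + ip (pd i y u) (pd k (pd j y) u).
Proof.
move=> Uu; rewrite -(partial_dot k (smooth_partial i sy) (smooth_partial j sy) Uu).
by congr (pd k _ u); apply/funext => t; rewrite induced_metricE.
Qed.

Lemma christoffelE k i j u : christoffel G k i j u = 2^-1 * \sum_l invmx (G u) k l *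
  (pd i (fun w => G w j l) u + pd j (fun w => G w i l) u - pd l (fun w => G w i j) u).
Proof. by rewrite pd.unlock. Qed.

(** Christoffel symbols of the first kind: in the alternating sum of derivatives of the metric
    everything cancels except twice <y_ij, y_k>. *)
Lemma christoffel_lower i j k u : U u ->
  \sum_m christoffel G m i j u * G u m k = ip (pd i (pd j y) u) (pd k y u).
Proof.
move=> Uu.
have T l : pd i (fun w => G w j l) u + pd j (fun w => G w i l) u
    - pd l (fun w => G w i j) u = 2 * ip (pd i (pd j y) u) (pd l y u).
  rewrite !pd_metric //.
  rewrite (partial_comm l j oU Uu sy) (partial_comm l i oU Uu sy).
  rewrite (partial_comm j i oU Uu sy) (dotC (pd i y u) (pd j (pd l y) u)).
  by rewrite (dotC (pd j y u)); ring.
have -> : \sum_m christoffel G m i j u * G u m k =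
    \sum_l ip (pd i (pd j y) u) (pd l y u) * (G u *m invmx (G u)) k l.
  under eq_bigr do rewrite christoffelE mulr_sumr mulr_suml.
  rewrite exchange_big; apply: eq_bigr => l _; rewrite mxE mulr_sumr.
  apply: eq_bigr => m _; rewrite T (_ : G u m k = G u k m); last first.
    by rewrite !induced_metricE dotC.
  by field.
rewrite mulmxV ?induced_metric_unit // (bigD1 k) //= big1 => [|l lk].
  by rewrite mxE eqxx mulr1 addr0.
by rewrite mxE eq_sym (negbTE lk) mulr0.
Qed.

(** Gauss's formula: the Christoffel terms remove exactly the tangential part of y_ij, so the
    Hessian of the immersion is normal. *)
Lemma hessian_tangent i j k u : U u -> ip (hessian G y i j u) (pd k y u) = 0.
Proof.
move=> Uu; rewrite /hessian dotDl dotNl dot_suml.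
have -> : partial i (partial j y) u = pd i (pd j y) u by rewrite pd.unlock.
rewrite -(christoffel_lower i j k Uu); apply/eqP; rewrite subr_eq0; apply/eqP.
by apply: eq_bigr => m _; rewrite dotZl induced_metricE pd.unlock.
Qed.

Lemma hessian_normal i j n u : (forall k, ip n (pd k y u) = 0) ->
  ip (hessian G y i j u) n = ip (pd i (pd j y) u) n.
Proof.
move=> nN; rewrite /hessian dotDl dotNl dot_suml big1 => [|k _].
  by rewrite subr0 pd.unlock.
have -> : partial k y u = pd k y u by rewrite pd.unlock.
by rewrite dotZl dotC nN mulr0.
Qed.

Lemma laplacian_dot n u :
  ip (lap u) n = - \sum_i \sum_j invmx (G u) i j * ip (hessian G y i j u) n.
Proof.
rewrite /laplacian dotNl dot_suml; congr (- _); apply: eq_bigr => i _.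
by rewrite dot_suml; apply: eq_bigr => j _; rewrite dotZl.
Qed.

Lemma laplacian_tangent k u : U u -> ip (lap u) (pd k y u) = 0.
Proof.
move=> Uu; rewrite laplacian_dot big1 ?oppr0 // => i _.
by rewrite big1 // => j _; rewrite hessian_tangent // mulr0.
Qed.

Lemma laplacian_normal n u : (forall k, ip n (pd k y u) = 0) ->
  ip (lap u) n = - \sum_i \sum_j invmx (G u) i j * ip (pd i (pd j y) u) n.
Proof.
move=> nN; rewrite laplacian_dot; congr (- _).
by apply: eq_bigr => i _; apply: eq_bigr => j _; rewrite hessian_normal.
Qed.

Lemma smooth_invmx i j : smooth_on U (fun t => invmx (G t) i j).
Proof.
have sG := smooth_metric.
(* The cofactor formula: a smooth numerator over a determinant that does not vanish on [U]. *)
apply: (smooth_open_eq oU (f := fun t => (G t i0 i0 * G t i1 i1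
  + -1 * (G t i0 i1 * G t i1 i0))^-1 *
  ((-1) ^+ (j + i) * G t (lift j ord0) (lift i ord0)))).
  move=> t Ut; rewrite invmx22E ?induced_metric_unit // det22E mulN1r.
  reflexivity.
apply: smoothM => //; last by apply: smoothM => //; exact: smooth_cst.
apply: smoothV => //.
  move=> t Ut; have := y_imm Ut; rewrite -det_induced_metric det22E.
  by rewrite mulN1r.
apply: smoothD; [exact: oU|exact: smoothM|].
by apply: smoothM; [exact: oU|exact: smooth_cst|exact: smoothM].
Qed.

Lemma smooth_christoffel k i j : smooth_on U (christoffel G k i j).
Proof.
have sG := smooth_metric.
rewrite (_ : christoffel G k i j = fun u => 2^-1 * \sum_l invmx (G u) k l *
  (pd i (fun w => G w j l) u + pd j (fun w => G w i l) u
   + -1 * pd l (fun w => G w i j) u)); last first.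
  apply/funext => u; rewrite christoffelE; congr (_ * _).
  by apply: eq_bigr => l _; rewrite mulN1r.
apply: smoothM; [exact: oU|exact: smooth_cst|].
apply: smooth_sum => // l; apply: smoothM; [exact: oU|exact: smooth_invmx|].
apply: smoothD; [exact: oU| |apply: smoothM;
  [exact: oU|exact: smooth_cst|exact: smooth_partial]].
by apply: smoothD; [exact: oU|exact: smooth_partial|exact: smooth_partial].
Qed.

Lemma smooth_vsum n m (F : 'I_m -> 'rV[R]_2 -> 'rV[R]_n) :
  (forall i, smooth_on U (F i)) -> smooth_on U (fun u => \sum_i F i u).
Proof.
move=> sF; apply/smooth_rowP => // k.
rewrite (_ : (fun _ => _) = fun u => \sum_i F i u 0 k).
  by apply: smooth_sum => // i; exact: ((smooth_rowP _ oU).1 (sF i) k).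
by apply/funext => u; rewrite summxE.
Qed.

Lemma smooth_laplacian : smooth_on U lap.
Proof.
apply: smoothN => //; apply: smooth_vsum => i; apply: smooth_vsum => j.
apply: smoothZ; [exact: oU|exact: smooth_invmx|].
apply: smoothD; first exact: oU.
  by do 2!apply: smooth_derive.
apply: smoothN => //; apply: smooth_vsum => k.
apply: smoothZ; [exact: oU|exact: smooth_christoffel|exact: smooth_derive].
Qed.

(* On a sphere the radius vector is normal and has constant length, so
   <y_ij, y - a> = - g_ij and the trace against g^-1 is the dimension 2. *)
Lemma laplacian_sphere a r u : 0 < r ->
  (forall t, U t -> ip (y t - a) (y t - a) = r ^+ 2) -> U u ->
  lap u = (2 / r ^+ 2) *: (y u - a).
Proof.
move=> r0 onS Uu.
have ssa : smooth_on U (fun t => y t - a).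
  by apply: smoothD => //; exact: smooth_cst.
have pa i t : U t -> pd i (fun t => y t - a) t = pd i y t.
  move=> Ut; rewrite (partial_sub i sy (smooth_cst _ a) Ut).
  by rewrite (partial_cst oU i Ut (f := fun=> a) (k := a)) // subr0.
have nN i t : U t -> ip (y t - a) (pd i y t) = 0.
  move=> Ut; have := partial_dot i ssa ssa Ut.
  rewrite (partial_cst oU i Ut onS) pa // (dotC (pd i y t)).
  by move/esym/eqP; rewrite -mulr2n mulrn_eq0 => /eqP.
have nn i j : ip (pd i (pd j y) u) (y u - a) = - G u i j.
  have := partial_dot i ssa (smooth_partial j sy) Uu.
  rewrite (partial_cst oU i Uu (nN j)) pa // induced_metricE.
  by move/esym/eqP; rewrite addrC addr_eq0 dotC => /eqP.
have n0 : y u - a != 0.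
  apply: contraTneq (exprn_gt0 2 r0) => a0.
  by rewrite -(onS u Uu) a0 dot0l ltxx.
apply: subr0_eq; apply: (basis3 (y_imm Uu) (nN i0 u Uu) (nN i1 u Uu) n0).
- by rewrite dotBl dotZl laplacian_tangent // nN // mulr0 subr0.
- by rewrite dotBl dotZl laplacian_tangent // nN // mulr0 subr0.
rewrite dotBl dotZl onS // laplacian_normal => [|k]; last exact: nN.
have -> : \sum_i \sum_j invmx (G u) i j * ip (pd i (pd j y) u) (y u - a) = - 2.
  transitivity (- \tr (invmx (G u) *m G u)).
    rewrite /mxtrace -sumrN; apply: eq_bigr => i _; rewrite mxE -sumrN.
    apply: eq_bigr => j _; rewrite nn mulrN !induced_metricE.
    by rewrite dotC.
  by rewrite mulVmx ?induced_metric_unit // mxtrace1.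
by rewrite divfK ?expf_neq0 ?gt_eqF // opprK subrr.
Qed.

End Laplacian.

Lemma pd_scale (R : realType) n (k : 'rV[R]_2 -> R) (g : 'rV[R]_2 -> 'rV[R]_n) i u :
  derivable k u (delta_mx 0 i) -> derivable g u (delta_mx 0 i) ->
  pd i (fun t => k t *: g t) u = pd i k u *: g u + k u *: pd i g u.
Proof. by rewrite pd.unlock; exact: derive_scale. Qed.

Lemma pd_add (R : realType) (W : normedModType R) (f g : 'rV[R]_2 -> W) i u :
  derivable f u (delta_mx 0 i) -> derivable g u (delta_mx 0 i) ->
  pd i (fun t => f t + g t) u = pd i f u + pd i g u.
Proof. by rewrite pd.unlock => df dg; exact: (@deriveD _ _ _ f g u _ df dg). Qed.

(** * Independence of the Laplacian of the immersion from the chart *)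

Section ChartChange.
Variables (R : realType) (U U' : set 'rV[R]_2).
Variables (y y' : 'rV[R]_2 -> 'rV[R]_3) (phi : 'rV[R]_2 -> 'rV[R]_2).
Hypotheses (oU : open U) (oU' : open U') (sphi : smooth_on U' phi).
Hypothesis phiU : forall t, U' t -> U (phi t).
Hypotheses (sy : smooth_on U y) (sy' : smooth_on U' y').
Hypothesis y'E : forall t, U' t -> y' t = y (phi t).
Hypothesis y_imm : forall u, U u -> gram (pd i0 y u) (pd i1 y u) != 0.
Hypothesis y'_imm : forall u, U' u -> gram (pd i0 y' u) (pd i1 y' u) != 0.

(** The transpose of the usual Jacobian matrix: rows index the direction of differentiation. *)
Let J t : 'M[R]_2 := \matrix_(i, k) pd i phi t 0 k.

Lemma differentiable_chart n (f : 'rV[R]_2 -> 'rV[R]_n) t :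
  smooth_on U f -> U' t -> differentiable (fun s => f (phi s)) t.
Proof.
move=> sf Ut; apply: (@differentiable_comp _ _ _ _ phi f).
  exact: smooth_diff sphi Ut.
exact: smooth_diff sf (phiU Ut).
Qed.

Lemma pd_chart n (f : 'rV[R]_2 -> 'rV[R]_n) i t : smooth_on U f -> U' t ->
  pd i (fun s => f (phi s)) t =
    J t i i0 *: pd i0 f (phi t) + J t i i1 *: pd i1 f (phi t).
Proof.
move=> sf Ut; have dphi := smooth_diff sphi Ut.
have df := smooth_diff sf (phiU Ut).
rewrite !mxE -derive_partialE // pd.unlock /partial.
rewrite !deriveE //; last exact: differentiable_chart.
have := diff_comp dphi df.
by move=> /(congr1 (fun h : 'rV[R]_2 -> 'rV[R]_n => h (delta_mx 0 i))).
Qed.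

Lemma pd_y' i t : U' t ->
  pd i y' t = J t i i0 *: pd i0 y (phi t) + J t i i1 *: pd i1 y (phi t).
Proof. by move=> Ut; rewrite -pd_chart //; exact: partial_open_eq y'E. Qed.

Lemma smooth_J i k : smooth_on U' (fun t => J t i k).
Proof.
rewrite (_ : (fun _ => _) = fun t => pd i phi t 0 k).
  exact: ((smooth_rowP _ oU').1 (smooth_partial i sphi) k).
by apply/funext => t; rewrite mxE.
Qed.

(** The terms with derivatives of [J] are tangential, so pairing with a normal vector makes second
    derivatives transform as a tensor. *)
Lemma pd2_y' i j n u : U' u -> (forall k, ip n (pd k y (phi u)) = 0) ->
  ip (pd j (pd i y') u) n =
    \sum_k \sum_l J u i k * (J u j l * ip (pd l (pd k y) (phi u)) n).
Proof.
move=> Uu nN.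
have term k : pd j (fun t => J t i k *: pd k y (phi t)) u =
    pd j (fun t => J t i k) u *: pd k y (phi u) +
    J u i k *: pd j (fun t => pd k y (phi t)) u.
  apply: pd_scale; first exact: smooth_derivable (smooth_J i k) Uu.
  by apply: diff_derivable; exact: (differentiable_chart (smooth_partial k sy) Uu).
have dk k : derivable (fun t => J t i k *: pd k y (phi t)) u (delta_mx 0 j).
  apply: derivable_scale; first exact: smooth_derivable (smooth_J i k) Uu.
  by apply: diff_derivable; exact: (differentiable_chart (smooth_partial k sy) Uu).
have -> : pd j (pd i y') u = pd j (fun t => J t i i0 *: pd i0 y (phi t)) u +
    pd j (fun t => J t i i1 *: pd i1 y (phi t)) u.
  by rewrite (partial_open_eq oU' j Uu (pd_y' i)); exact: pd_add (dk i0) (dk i1).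
have sk k := smooth_partial k sy.
rewrite !sum2E !term !(pd_chart j (sk _) Uu) !dotE.
by rewrite !(dotC _ n) !nN; ring.
Qed.

Lemma metric_chart u : U' u ->
  induced_metric y' u = J u *m induced_metric y (phi u) *m (J u)^T.
Proof.
move=> Uu; apply/matrixP => i j.
have mulE (B C : 'M[R]_2) a e : (B *m C) a e = B a i0 * C i0 e + B a i1 * C i1 e.
  by rewrite mxE sum2E.
have trE (B : 'M[R]_2) a e : B^T a e = B e a by rewrite mxE.
rewrite !mulE !trE !induced_metricE !(pd_y' _ Uu) !dotE.
by rewrite (dotC (pd i1 y _) (pd i0 y _)); ring.
Qed.

Lemma J_unit u : U' u -> J u \in unitmx.
Proof.
move=> Uu; rewrite unitmxE unitfE; apply: contraNneq (y'_imm Uu) => J0.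
by rewrite -det_induced_metric metric_chart // !det_mulmx J0 !mul0r.
Qed.

Lemma normal_chart n u : U' u -> (forall k, ip n (pd k y' u) = 0) ->
  forall k, ip n (pd k y (phi u)) = 0.
Proof.
move=> Uu nN k; pose nv : 'cV[R]_2 := \col_k ip n (pd k y (phi u)).
have J0 : J u *m nv = 0.
  apply/colP => i; rewrite mxE sum2E [RHS]mxE -[RHS](nN i) (pd_y' i Uu).
  by rewrite !dotE [nv i0 0]mxE [nv i1 0]mxE.
have : nv k 0 = 0 by rewrite -[nv](mulKmx (J_unit Uu)) J0 mulmx0 mxE.
by rewrite mxE.
Qed.

(** The difference of the two vectors is itself normal, hence an admissible [n]. *)
Lemma normal_eq_chart l l' u : U' u ->
  (forall k, ip l' (pd k y' u) = 0) -> (forall k, ip l (pd k y (phi u)) = 0) ->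
  (forall n, (forall k, ip n (pd k y' u) = 0) ->
    (forall k, ip n (pd k y (phi u)) = 0) -> ip l' n = ip l n) -> l' = l.
Proof.
move=> Uu l'N lN nE; have l'N2 := normal_chart Uu l'N.
have lN' k : ip l (pd k y' u) = 0.
  by rewrite (pd_y' k Uu) dotDr !dotZr !lN !mulr0 addr0.
apply: subr0_eq; apply: dot_eq0; rewrite dotBl nE ?subrr // => k.
  by rewrite dotBl l'N lN' subr0.
by rewrite dotBl l'N2 lN subr0.
Qed.

(** Both sides are normal, and pairing with a normal vector gives - tr (g^-1 h). As g and h become J
    g J^T and J h J^T, the trace is unchanged. *)
Lemma laplacian_chart u : U' u ->
  laplacian (induced_metric y') y' u = laplacian (induced_metric y) y (phi u).
Proof.
move=> Uu; have Up := phiU Uu.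
apply: (normal_eq_chart Uu).
- by move=> k; exact: (laplacian_tangent oU' sy' y'_imm k Uu).
- by move=> k; exact: (laplacian_tangent oU sy y_imm k Up).
move=> n nN' nN; apply: (etrans (laplacian_normal nN')); apply/esym.
apply: (etrans (laplacian_normal nN)); apply/esym; apply: (congr1 -%R).
pose h : 'M[R]_2 := \matrix_(i, j) ip (pd j (pd i y) (phi u)) n.
have hE : \sum_i \sum_j invmx (induced_metric y (phi u)) i j *
    ip (pd i (pd j y) (phi u)) n = \tr (invmx (induced_metric y (phi u)) *m h).
  by apply: eq_bigr => i _; rewrite mxE; apply: eq_bigr => j _; rewrite mxE.
have hE' : \sum_i \sum_j invmx (induced_metric y' u) i j *
    ip (pd i (pd j y') u) n =
    \tr (invmx (induced_metric y' u) *m (J u *m h *m (J u)^T)).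
  apply: eq_bigr => i _; rewrite mxE; apply: eq_bigr => j _; congr (_ * _).
  rewrite (pd2_y' _ _ Uu nN) mxE !sum2E.
  have mulE (B C : 'M[R]_2) a e : (B *m C) a e = B a i0 * C i0 e + B a i1 * C i1 e.
    by rewrite mxE sum2E.
  have trE (B : 'M[R]_2) a e : B^T a e = B e a by rewrite mxE.
  by rewrite !mulE !trE ![h _ _]mxE; ring.
rewrite hE hE' metric_chart //.
have uJ := J_unit Uu; have uJT : (J u)^T \in unitmx by rewrite unitmx_tr.
have uG := induced_metric_unit y_imm Up.
have -> : invmx (J u *m induced_metric y (phi u) *m (J u)^T) =
    invmx (J u)^T *m invmx (induced_metric y (phi u)) *m invmx (J u).
  have uA : J u *m induced_metric y (phi u) *m (J u)^T \in unitmx.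
    by rewrite !unitmx_mul uJ uG.
  apply: (can_inj (mulKmx uA)); rewrite mulmxV //.
  by rewrite !mulmxA mulmxK // mulmxK // mulmxV.
rewrite -!mulmxA mxtrace_mulC -!mulmxA mulKmx //.
by rewrite mulmxV // mulmx1.
Qed.

End ChartChange.

(** * Immersions into a sphere are open *)

Section SphereOpen.
Variables (R : realType) (U : set 'rV[R]_2) (y : 'rV[R]_2 -> 'rV[R]_3).
Hypotheses (oU : open U) (sy : smooth_on U y).
Hypothesis y_imm : forall u, U u -> gram (pd i0 y u) (pd i1 y u) != 0.

Lemma derive_lower_bound u : U u ->
  exists2 m, 0 < m & forall h, m * `|h| <= `|'D_h y u|.
Proof.
move=> Uu; set a := pd i0 y u; set b := pd i1 y u.
have G0 : 0 < gram a b by rewrite lt0r y_imm //= gram_ge0.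
(* Up to the factor [gram a b], [p] and [q] form the dual basis of [a], [b], so they recover the
   coordinates of [h] from its image. *)
pose p := ip b b *: a - ip a b *: b; pose q := ip a a *: b - ip a b *: a.
pose K := 3 * (`|p| + `|q|) + 1.
have K0 : 0 < K by rewrite ltr_wpDl // mulr_ge0 // addr_ge0.
exists (gram a b / K) => [|h]; first exact: divr_gt0.
rewrite mulrAC ler_pdivrMr //.
have Dh : 'D_h y u = h 0 i0 *: a + h 0 i1 *: b.
  exact: derive_partialE (smooth_diff sy Uu).
have h0 : gram a b * h 0 i0 = ip ('D_h y u) p.
  by rewrite Dh /p /gram !dotE (dotC b a); ring.
have h1 : gram a b * h 0 i1 = ip ('D_h y u) q.
  by rewrite Dh /q /gram !dotE (dotC b a); ring.
move: ('D_h y u) h0 h1 => d h0 h1.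
have bound t (s : 'rV[R]_3) : gram a b * t = ip d s -> `|s| <= `|p| + `|q| ->
    `|t| <= `|d| * K / gram a b.
  move=> E sK; rewrite ler_pdivlMr // -{1}(gtr0_norm G0) mulrC -normrM E.
  rewrite (le_trans (dot_le_norm _ _)) // mulrCA ler_wpM2l //.
  by rewrite (@le_trans _ _ (3 * (`|p| + `|q|))) ?ler_wpM2l // lerDl.
rewrite mulrC -ler_pdivlMr //; apply: norm_le_coord.
  by rewrite divr_ge0 ?mulr_ge0 // ltW.
apply: ord2P; first by apply: bound h0 _; rewrite lerDl.
by apply: bound h1 _; rewrite lerDr.
Qed.

(** The differential expands lengths by at least some factor, and near [u] the remainder takes away
    at most half of it. *)
Lemma local_separation u : U u -> exists m d, [/\ 0 < m, 0 < d &
  forall h, `|h| < d -> U (u + h) /\ m * `|h| <= `|y (u + h) - y u|].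
Proof.
move=> Uu; have [m m0 mh] := derive_lower_bound Uu.
have dy := smooth_diff sy Uu.
have e0 : 0 < m / 2 by rewrite divr_gt0.
have nh : \forall h \near (0 : 'rV[R]_2),
    `|(y \o shift u - (cst (y u) + 'd y u)) h| <= m / 2 * `|h|.
  by have := diff_locally dy; move/eqaddoP => /(_ _ e0).
have nU : \forall h \near (0 : 'rV[R]_2), U (u + h).
  have : \forall w \near u, U w by exact: open_nbhs_nbhs.
  by rewrite (near_shift 0 u) /= => H; apply: filterS H => h; rewrite subr0 addrC.
have : \forall h \near (0 : 'rV[R]_2), U (u + h) /\
    `|(y \o shift u - (cst (y u) + 'd y u)) h| <= m / 2 * `|h|.
  exact: filterI.
move=> /nbhs_normP[d /= d0 Hd].
exists (m / 2), d; split => // h hd.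
have [Uh nhh] : U (u + h) /\
    `|(y \o shift u - (cst (y u) + 'd y u)) h| <= m / 2 * `|h|.
  by apply: Hd => /=; rewrite sub0r normrN.
split => //.
have {nhh} : `|y (u + h) - y u - 'D_h y u| <= m / 2 * `|h|.
  rewrite deriveE // -addrA -opprD addrC [u + h]addrC.
  by move: nhh; rewrite /= addrC.
have := mh h; move: ('D_h y u) (y (u + h) - y u) => D z le1 le2.
have : `|D| <= `|z| + `|z - D|.
  by rewrite -{1}(subKr z D) (le_trans (ler_normB _ _)).
move=> le3; have := le_trans le1 (le_trans le3 (lerD (lexx _) le2)).
by rewrite -lerBlDr -mulrBl {1}(splitr m) addrK.
Qed.

(* A minimum is critical: Z - y c is then normal to the surface, like the
   radius at y c, so that Z is y c or its antipode. *)
Lemma sphere_critical a r Z c : 0 < r ->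
  (forall t, U t -> ip (y t - a) (y t - a) = r ^+ 2) -> U c ->
  ip (Z - a) (Z - a) = r ^+ 2 ->
  (forall k, ip (pd k y c) (y c - Z) = 0) ->
  ip (y c - Z) (y c - Z) < 4 * r ^+ 2 -> y c = Z.
Proof.
move=> r0 onS Uc ZS crit far.
have nN k : ip (y c - a) (pd k y c) = 0.
  have ssa : smooth_on U (fun t => y t - a).
    by apply: smoothD => //; exact: smooth_cst.
  have := partial_dot k ssa ssa Uc.
  rewrite (partial_cst oU k Uc onS) (partial_sub k sy (smooth_cst _ a) Uc).
  rewrite (partial_cst oU k Uc (f := fun=> a) (k := a)) // subr0.
  rewrite (dotC (pd k y c)).
  by move/esym/eqP; rewrite -mulr2n mulrn_eq0 => /eqP.
have nZ k : ip (y c - Z) (pd k y c) = 0 by rewrite dotC.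
have := normal_parallel (y_imm Uc) (nN i0) (nN i1) (nZ i0) (nZ i1).
have := onS c Uc; move: ZS far.
have -> : Z - a = (y c - a) - (y c - Z) by rewrite opprB [RHS]addrC subrKA.
move=> hZ far hn gr; apply: subr0_eq; apply: dot_eq0.
move: hZ far hn gr; rewrite /gram; move: (y c - a) (y c - Z) => n d.
rewrite !dotE (dotC d n); move: (ip n n) (ip n d) (ip d d) => S P Q.
move=> hZ far hS; rewrite hS in hZ *; move=> gr.
have QP : Q = 2 * P by lra.
have rn : r != 0 by rewrite gt_eqF.
have : P * (2 * r ^+ 2 - P) = 0 by rewrite -gr QP; ring.
move/eqP; rewrite mulf_eq0 => /orP[/eqP P0|/eqP P2]; first by rewrite QP P0 mulr0.
by move: far; rewrite QP (_ : P = 2 * r ^+ 2) ?mulrA ?ltxx //; [lra|lra].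
Qed.

(** Fermat's criterion on the line through [c] in direction [v]; the denominator [|v| + 1] in the
    choice of [s] also covers [v = 0]. *)
Lemma critical_point (F : 'rV[R]_2 -> R) c v e : 0 < e ->
  (forall h, `|h| < e -> differentiable F (c + h) /\ F c <= F (c + h)) ->
  'D_v F c = 0.
Proof.
move=> e0 H; pose s := e / (`|v| + 1).
have v1 : 0 < `|v| + 1 by rewrite ltr_wpDl.
have s0 : 0 < s by rewrite divr_gt0.
have small t : t \in `](- s), s[%R -> `|t *: v| < e.
  rewrite in_itv /= => /andP[t1 t2].
  have ts : `|t| < s by rewrite ltr_norml t1.
  rewrite normrZ (@le_lt_trans _ _ (`|t| * (`|v| + 1))) //.
    by rewrite ler_wpM2l // lerDl.
  by rewrite -ltr_pdivlMr.
have dl t : t \in `](- s), s[%R ->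
    is_derive t 1 (fun r : R => F (c + r *: v)) ('D_v F (c + t *: v)).
  by move=> ts; apply: is_derive_line; apply: diff_derivable; case: (H _ (small t ts)).
have z0 : (0 : R) \in `](- s), s[%R by rewrite in_itv /= oppr_lt0 s0.
have ss : - s <= s by rewrite ge0_cp ?ltW.
have D1 := @derive1_at_min R (fun r : R => F (c + r *: v)) (- s) s 0 ss
  (fun t ts => @ex_derive _ _ _ _ _ _ _ (dl t ts)) z0
  (fun t ts => eq_ind_r (fun p => F p <= _) (H _ (small t ts)).2
    (etrans (congr1 (+%R c) (scale0r v)) (addr0 c))).
have := @derive_val _ _ _ _ _ _ _ (dl 0 z0).
by rewrite (@derive_val _ _ _ _ _ _ _ D1) scale0r addr0.
Qed.

Lemma sphere_open a r u : 0 < r ->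
  (forall t, U t -> ip (y t - a) (y t - a) = r ^+ 2) -> U u ->
  \forall Z \near y u, ip (Z - a) (Z - a) = r ^+ 2 -> exists2 t, U t & y t = Z.
Proof.
move=> r0 onS Uu.
have [m [d [m0 d0 sep]]] := local_separation Uu.
pose dl := d / 2; have dl0 : 0 < dl by rewrite divr_gt0.
have dld : dl < d by rewrite /dl ltr_pdivrMr // ltr_pMr // ltr1n.
(* The first bound forces the minimum into the interior of the disc, the second keeps [y c] away
   from the antipode of [Z]. *)
pose eta := Num.min (m * dl / 4) (r / 2).
have eta0 : 0 < eta by rewrite lt_min !divr_gt0 ?mulr_gt0.
have eta1 : 4 * eta <= m * dl by rewrite mulrC -ler_pdivlMr // ge_min lexx.
have eta2 : 2 * eta <= r by rewrite mulrC -ler_pdivlMr // ge_min lexx orbT.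
apply/nbhs_normP; exists eta => //= Z Zu ZS.
pose K := closed_ball_ Num.norm u dl.
have KU t : K t -> U t.
  move=> Kt; have [] // := sep (t - u) _; last by rewrite addrC subrK.
  by rewrite distrC; exact: le_lt_trans Kt dld.
have cK : compact K.
  apply: bounded_closed_compact; last exact: closed_closed_ball_.
  exists (`|u| + dl); split; first by rewrite num_real.
  move=> M hM t /= Kt; apply: le_trans (ltW hM).
  by rewrite -lerBlDl (le_trans (lerB_dist _ _)) // distrC.
pose F t := ip (y t - Z) (y t - Z).
have sF : smooth_on U F.
  by apply: smooth_dot => //; apply: smoothD => //; exact: smooth_cst.
have Ku : K u by rewrite /K /closed_ball_ /= subrr normr0 ltW.
have [c] : exists2 c, c \in K & forall t, t \in K -> F c <= F t.
  apply: EVT_min_rV => //; first by exists u.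
  apply: continuous_in_subspaceT => t; rewrite inE => Kt.
  exact: sF 0%N t (KU _ Kt).
rewrite inE => Kc Fmin.
(* Comparison with the sup norm in dimension 3 gives [F u <= 3 * eta ^+ 2]. *)
have Fu : F u < 4 * eta ^+ 2.
  have := dot_le_norm (y u - Z) (y u - Z).
  rewrite ger0_norm ?dot_ge0 // => /le_lt_trans; apply.
  rewrite -expr2; have : `|y u - Z| ^+ 2 <= eta ^+ 2.
    by rewrite ler_sqr ?nnegrE // ltW.
  have := exprn_gt0 2 eta0; move: (_ ^+ 2) (eta ^+ 2) => A B; lra.
have Fc : F c < 4 * eta ^+ 2.
  by apply: le_lt_trans Fu; apply: Fmin; rewrite inE.
(* If [c] were on the boundary, [sep] would give |y c - y u| >= m dl >= 4 eta, whereas passing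
   through [Z] bounds this distance by 3 eta. *)
have cint : `|c - u| < dl.
  rewrite lt_neqAle distrC Kc andbT; apply/negP => /eqP E.
  have cd : `|c - u| < d by rewrite distrC E.
  have [_] := sep (c - u) cd; rewrite [u + _]addrC subrK (distrC c u) E => sc.
  have yZ : `|y c - Z| < 2 * eta.
    rewrite -(@ltr_sqr R) ?nnegrE ?mulr_ge0 // 1?ltW // exprMn.
    rewrite (le_lt_trans (norm_sqr_le_dot _)) // (lt_le_trans Fc) //.
    by rewrite -natrX.
  have : `|y c - y u| <= `|y c - Z| + `|Z - y u|.
    by rewrite -(subrKA Z) ler_normD.
  move: Zu; rewrite /ball_ /= distrC; move: sc yZ eta1 eta0.
  move: (`|y c - y u|) (`|y c - Z|) (`|Z - y u|) (m * dl) => A B C D; lra.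
exists c; first exact: KU.
apply: (sphere_critical r0 onS (KU _ Kc) ZS); last first.
  apply: lt_le_trans Fc _; rewrite ler_wpM2l // ler_sqr ?nnegrE; [|exact: ltW..].
  by move: eta2 eta0; lra.
move=> k.
have syZ : smooth_on U (fun t => y t - Z) by apply: smoothD => //; exact: smooth_cst.
have : pd k F c = 0.
  rewrite pd.unlock; apply: (@critical_point F c _ (dl - `|c - u|)).
    by rewrite subr_gt0.
  move=> h hh; have Kh : K (c + h).
    rewrite /K /closed_ball_ /= distrC addrAC (le_trans (ler_normD _ _)) //.
    by rewrite -lerBrDl ltW.
  split; first exact: smooth_diff sF (KU _ Kh).
  by apply: Fmin; rewrite inE.
rewrite (partial_dot k syZ syZ (KU _ Kc)) (partial_sub k sy (smooth_cst _ Z) (KU _ Kc)).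
rewrite (partial_cst oU k (KU _ Kc) (f := fun=> Z) (k := Z)) // subr0.
rewrite (dotC (y c - Z)).
by move=> /eqP; rewrite -mulr2n mulrn_eq0 => /eqP.
Qed.

End SphereOpen.

(** * Surfaces *)

Lemma derive_affine (R : realType) (V W : normedModType R) (f : V -> W) k a u v :
  derivable f u v -> 'D_v (fun t => k *: (f t - a)) u = k *: 'D_v f u.
Proof.
move=> df; have da := derivable_cst a u v.
have db := @derivableB _ _ _ f (fun=> a) u v df da.
apply: (etrans (@deriveZ _ _ _ (f - fun=> a) k u v db)).
rewrite (@deriveB _ _ _ f (fun=> a) u v df da) (derive_cst a u v) subr0.
reflexivity.
Qed.

(** With [l] the Laplacian of [y], the hypothesis on <l, l> is [laplacian_normal] for [n = l]; since
    <y_i, l_j> = - <y_ij, l>, it becomes the trace condition. *)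
Lemma laplace_isometricI (R : realType) (U : set 'rV[R]_2) c
    (y l : 'rV[R]_2 -> 'rV[R]_3) :
  open U -> smooth_on U y -> smooth_on U l -> 0 < c ->
  (forall u, U u -> gram (pd i0 y u) (pd i1 y u) != 0) ->
  (forall k u, U u -> ip (l u) (pd k y u) = 0) ->
  (forall u, U u -> ip (l u) (l u) = - \sum_i \sum_j
    invmx (induced_metric y u) i j * ip (pd i (pd j y) u) (l u)) ->
  (forall i j u, U u -> ip (pd i l u) (pd j l u) =
    c ^+ 2 * ip (pd i y u) (pd j y u)) ->
  laplace_isometric U y (fun u => c^-1 *: l u) c.
Proof.
move=> oU sy sl c0 y_imm lN ltr lisom.
have cn : c != 0 by rewrite gt_eqF.
have sc : smooth_on U (fun _ : 'rV[R]_2 => c^-1) by exact: smooth_cst.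
have pz k u : U u -> pd k (fun t => c^-1 *: l t) u = c^-1 *: pd k l u.
  move=> Uu; rewrite (partial_scale k sc sl Uu).
  by rewrite (partial_cst oU k Uu (f := fun=> c^-1) (k := c^-1)) // scale0r add0r.
have hE i j u : U u -> ip (pd i y u) (pd j l u) = - ip (pd j (pd i y) u) (l u).
  move=> Uu; have := partial_dot j sl (smooth_partial i sy) Uu.
  rewrite (partial_cst oU j Uu (lN i)) (dotC (l u)) (dotC (pd j l u)).
  by move/esym/eqP; rewrite addr_eq0 => /eqP.
split; [exact: oU|exact: sy|exact: (smoothZ oU sc sl)|exact: c0|exact: y_imm|..].
- by move=> k u Uu; rewrite dotZl (lN k u Uu) mulr0.
- move=> i j u Uu; rewrite /mixed_metric (pz i u Uu) (pz j u Uu) dotZl dotZr.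
  by rewrite (lisom i j u Uu); field.
move=> u Uu; rewrite /mixed_metric /sq_norm !(pz _ u Uu) !dotZr !dotZl.
rewrite !(hE _ _ u Uu) (ltr u Uu) inv22_sum; last first.
  by rewrite unitmxE unitfE det_induced_metric y_imm.
rewrite det_induced_metric !induced_metricE (dotC (pd i1 y u) (pd i0 y u)).
rewrite (partial_comm i0 i1 oU Uu sy); have := y_imm u Uu.
move: (gram _ _) (ip _ (l u)) (ip _ (l u)) (ip _ (l u)) => D h00 h01 h11 Dn.
by field; rewrite Dn cn.
Qed.

Section Surfaces.
Variables (R : realType) (M : topologicalType) (A : surface_atlas R M).

Lemma transition_open (i j : chart_index A) :
  open (chart i @` (dom i `&` dom j)).
Proof.
rewrite openE => u [p [pi pj] <-].
have Iu : (chart i @` dom i) (chart i p) by exists p.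
have nI := open_nbhs_nbhs (conj (@img_open _ _ A i) Iu).
have cP := param_continuous Iu.
have nD : \forall t \near chart i p, dom j (param i t).
  by apply: cP; rewrite chartK //; exact: open_nbhs_nbhs (conj (@dom_open _ _ A j) pj).
apply: filterS2 nI nD => t [q iq <-]; rewrite chartK // => jq.
by exists q.
Qed.

(** The mean value theorem on segments in a chart ball makes [h] locally constant, so its level sets
    are open and closed. *)
Lemma const_of_charts (h : M -> R) : connected [set: M] ->
  (forall (i : chart_index A) u, img i u -> differentiable (in_chart i h) u /\
    forall v, 'D_v (in_chart i h) u = 0) ->
  forall p q, h p = h q.
Proof.
move=> cM H p q.
have loc p' : \forall p'' \near p', h p'' = h p'.
  have [i pi] := dom_cover A p'; set u := chart i p'.
  have Iu : img i u by exists p'.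
  have : \forall w \near u, img i w by exact: open_nbhs_nbhs (conj (@img_open _ _ A i) Iu).
  move=> /nbhs_normP[e /= e0 He].
  have nc : \forall p'' \near p', `|u - chart i p''| < e.
    exact: (cvgrPdist_lt _ _).1 (chart_continuous pi) e e0.
  have nd : \forall p'' \near p', dom i p''.
    exact: open_nbhs_nbhs (conj (@dom_open _ _ A i) pi).
  apply: filterS2 nc nd => p'' hc pi''.
  have inI t : 0 <= t <= 1 -> img i (u + t *: (chart i p'' - u)).
    move=> /andP[t0 t1]; apply: He => /=.
    rewrite opprD addrA subrr sub0r normrN normrZ ger0_norm // distrC.
    by rewrite (le_lt_trans _ hc) // ler_piMl.
  have [t t01] := @MVT_line _ _ (in_chart i h) u (chart i p'' - u) 1 ler01
    (fun t t01 => (H i _ (inI t t01)).1).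
  rewrite (H i _ (inI t t01)).2 mulr0 scale1r [u + _]addrC subrK.
  by rewrite /in_chart /= /u !chartK // => /subr0_eq.
have := cM [set p' | h p' = h q] _ _ _.
move=> /(_ (ex_intro _ q erefl)) E.
have : [set p' | h p' = h q] p; last by [].
rewrite E //.
- exists [set p' | h p' = h q]; last by rewrite setTI.
  by rewrite openE => p' hp'; apply: filterS (loc p') => p'' /= ->.
- exists [set p' | h p' = h q]; last by rewrite setTI.
  rewrite -openC openE => p' hp'; apply: filterS (loc p') => p'' /= ->.
  exact: hp'.
Qed.

Lemma gram_injective (y : 'rV[R]_2 -> 'rV[R]_3) u : differentiable y u ->
  injective (fun v => 'D_v y u) -> gram (pd i0 y u) (pd i1 y u) != 0.
Proof.
move=> dy inj; set a := pd i0 y u; set b := pd i1 y u.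
have ker (s t : R) : s *: a + t *: b = 0 -> s = 0 /\ t = 0.
  move=> st; pose v : 'rV[R]_2 := s *: delta_mx 0 i0 + t *: delta_mx 0 i1.
  have i01 : (i0 == i1) = false by rewrite i0.unlock i1.unlock.
  have v0 : v 0 i0 = s.
    by rewrite !mxE !eqxx i01 /= mulr0 mulr1 addr0.
  have v1 : v 0 i1 = t.
    by rewrite !mxE !eqxx eq_sym i01 /= mulr0 mulr1 add0r.
  have : v = 0 by apply: inj; rewrite derive0 derive_partialE // v0 v1.
  by move=> vz; rewrite -v0 -v1 vz !mxE.
apply/eqP => G0.
(* The squared length of this vector is <a, a> times the Gram determinant. *)
have E : ip a b *: a + (- ip a a) *: b = 0.
  apply: dot_eq0; rewrite !dotE (dotC b a).
  transitivity (ip a a * gram a b); last by rewrite G0 mulr0.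
  by rewrite /gram; ring.
have [_ /eqP] := ker _ _ E; rewrite oppr_eq0 => /eqP /dot_eq0 a0.
have [/eqP] : (1 : R) = 0 /\ (0 : R) = 0.
  by apply: ker; rewrite a0 scaler0 scale0r addr0.
by rewrite oner_eq0.
Qed.

Variable x : M -> 'rV[R]_3.
Hypothesis x_imm : immersion A x.

Local Notation X i := (in_chart i x).

Lemma chart_smooth (i : chart_index A) : smooth_on (img i) (X i).
Proof. by have [sx _] := x_imm; exact: sx. Qed.

Lemma chart_imm (i : chart_index A) u : img i u ->
  gram (pd i0 (X i) u) (pd i1 (X i) u) != 0.
Proof.
move=> [p pi <-]; apply: gram_injective.
  by apply: smooth_diff (chart_smooth i) _; exists p.
by have [_ inj] := x_imm; exact: inj pi.
Qed.

Lemma laplace_map_at p : exists2 j : chart_index A, dom j p &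
  laplace_map A x p = laplacian (induced_metric (X j)) (X j) (chart j p).
Proof. by exists (chart_at A p); [exact: (projT2 (cid (dom_cover A p)))|]. Qed.

(** [laplace_map] picks a chart point by point; chart independence replaces it by one fixed chart on
    its whole domain, where the map can be differentiated. *)
Lemma laplace_map_chart (i : chart_index A) u : img i u ->
  in_chart i (laplace_map A x) u = laplacian (induced_metric (X i)) (X i) u.
Proof.
move=> [p pi <-]; have [j pj Lp] := laplace_map_at p.
set U' := chart i @` (dom i `&` dom j).
have U'i : U' `<=` img i by move=> _ [q [iq _] <-]; exists q.
have key : laplacian (induced_metric (X i)) (X i) (chart i p) =
    laplacian (induced_metric (X j)) (X j) ((chart j \o param i) (chart i p)).
  apply: (@laplacian_chart _ (img j) U' (X j) (X i) (chart j \o param i)).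
  - exact: img_open.
  - exact: transition_open.
  - exact: transition_smooth.
  - move=> _ [q [iq jq] <-]; exists q; first exact: jq.
    exact: (congr1 (chart j) (esym (chartK iq))).
  - exact: chart_smooth.
  - exact: smooth_sub_open U'i (chart_smooth i).
  - move=> _ [q [iq jq] <-].
    exact: (congr1 x (etrans (chartK iq) (esym
      (etrans (congr1 (param j \o chart j) (chartK iq)) (chartK jq))))).
  - exact: chart_imm.
  - by move=> t /U'i; exact: chart_imm.
  - by exists p; [split|].
apply: (etrans (congr1 (laplace_map A x) (chartK pi))); apply: (etrans Lp).
apply/esym; apply: (etrans key).
exact: (congr1 (laplacian _ _ \o chart j) (chartK pi)).
Qed.

Lemma homothetic_of_sphere a r : 0 < r ->
  (forall p, ip (x p - a) (x p - a) = r ^+ 2) -> homothetic A x (laplace_map A x).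
Proof.
move=> r0 onS; set c := 2 / r ^+ 2.
have c0 : 0 < c by rewrite divr_gt0 // exprn_gt0.
have LE : laplace_map A x = fun p => c *: (x p - a).
  apply/funext => p; have [j pj Lp] := laplace_map_at p; apply: (etrans Lp).
  apply: (etrans (laplacian_sphere (@img_open _ _ A j) (chart_smooth j)
    (@chart_imm j) (a := a) r0 _ _)).
  - by move=> t _; exact: onS.
  - by exists p.
  exact: (congr1 (fun q => c *: (x q - a)) (chartK pj)).
exists c => // i p pi V W; rewrite LE.
have T v : tangent_map (fun p => c *: (x p - a)) i p v = c *: tangent_map x i p v.
  have dx : derivable (X i) (chart i p) v.
    by apply: smooth_derivable (chart_smooth i) _; exists p.
  exact: (derive_affine c a dx).
have := (T V, T W); move=> [-> ->].
have dE (s t : 'rV[R]_3) : dot s t = ip s t by rewrite ip.unlock.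
by rewrite !dE dotZl dotZr mulrA expr2.
Qed.

Lemma sphere_of_homothetic : connected [set: M] ->
  homothetic A x (laplace_map A x) -> M ->
  exists a r, 0 < r /\ forall p, ip (x p - a) (x p - a) = r ^+ 2.
Proof.
move=> cM [c c0 Hc] p0.
have cn : c != 0 by rewrite gt_eqF.
(* The chart expressions of the Laplace map are kept abstract, known only through the four
   properties used below. *)
have [l [lE sl lN ltr]] : exists l : chart_index A -> 'rV[R]_2 -> 'rV[R]_3,
  [/\ forall (i : chart_index A) u, img i u -> in_chart i (laplace_map A x) u = l i u,
      forall (i : chart_index A), smooth_on (img i) (l i),
      forall (i : chart_index A) k u, img i u -> ip (l i u) (pd k (X i) u) = 0 &
      forall (i : chart_index A) u, img i u -> ip (l i u) (l i u) = - \sum_k \sum_m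
        invmx (induced_metric (X i) u) k m * ip (pd k (pd m (X i)) u) (l i u)].
  exists (fun i : chart_index A => laplacian (induced_metric (X i)) (X i)).
  have lN (i : chart_index A) k u : img i u ->
      ip (laplacian (induced_metric (X i)) (X i) u) (pd k (X i) u) = 0.
    exact: (laplacian_tangent (@img_open _ _ A i) (chart_smooth i) (@chart_imm i) k).
  split; [exact: laplace_map_chart| |exact: lN|].
    move=> i.
    exact: smooth_laplacian (@img_open _ _ A i) (chart_smooth i) (@chart_imm i).
  by move=> i u Iu; apply: laplacian_normal => k; exact: lN.
pose L := laplace_map A x.
have {}lE (i : chart_index A) u : img i u -> in_chart i L u = l i u by exact: lE.
have lisom (i : chart_index A) k m u : img i u -> ip (pd k (l i) u) (pd m (l i) u) =
    c ^+ 2 * ip (pd k (X i) u) (pd m (X i) u).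
  move=> Iu; have [p pi pu] := Iu.
  have := Hc i p pi (delta_mx 0 k) (delta_mx 0 m); rewrite /tangent_map pu.
  have E v : 'D_v (in_chart i (laplace_map A x)) u = 'D_v (l i) u.
    exact: derive_open_eq (@img_open _ _ A i) Iu (lE i).
  by rewrite (E (delta_mx 0 k)) (E (delta_mx 0 m)) ip.unlock pd.unlock.
clearbody L; clear Hc.
have H (i : chart_index A) := laplace_isometricI (@img_open _ _ A i) (chart_smooth i) (sl i) c0
  (@chart_imm i) (lN i) (ltr i) (lisom i).
pose z (i : chart_index A) := fun u => c^-1 *: l i u.
have rig (i : chart_index A) k u : img i u -> pd k (sq_norm (z i)) u = 0 /\
    pd k (fun t => X i t - z i t) u = 0.
  exact: laplace_isometric_rigid (H i).
have sz (i : chart_index A) : smooth_on (img i) (z i) by exact: li_smooth_normal (H i).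
have sq (i : chart_index A) : smooth_on (img i) (fun t => X i t - z i t).
  exact: smoothD (@img_open _ _ A i) (chart_smooth i) (smoothN (@img_open _ _ A i) (sz i)).
have sw (i : chart_index A) : smooth_on (img i) (sq_norm (z i)).
  exact: smooth_dot (@img_open _ _ A i) (sz i) (sz i).
have const (h : M -> R) (hl : chart_index A -> 'rV[R]_2 -> R) :
    (forall (i : chart_index A) u, img i u -> in_chart i h u = hl i u) ->
    (forall (i : chart_index A), smooth_on (img i) (hl i)) ->
    (forall (i : chart_index A) k u, img i u -> pd k (hl i) u = 0) -> forall p q, h p = h q.
  move=> hE sh dh; apply: (const_of_charts cM) => i u Iu; split.
    apply: (differentiable_open_eq (@img_open _ _ A i) Iu _ (smooth_diff (sh i) Iu)).
    by move=> t It; rewrite hE.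
  move=> v; rewrite (derive_open_eq v (@img_open _ _ A i) Iu (hE i)).
  rewrite derive_partialE; last exact: smooth_diff (sh i) Iu.
  by rewrite !dh // !scaler0 addr0.
pose N p := c^-1 *: L p.
have NE (i : chart_index A) u : img i u -> in_chart i N u = z i u.
  by move=> Iu; rewrite /z -(lE i u Iu).
have Nconst p q : ip (N p) (N p) = ip (N q) (N q).
  apply: (const (fun p => ip (N p) (N p)) (fun i => sq_norm (z i))) => //.
    by move=> i u Iu; rewrite /sq_norm -(NE i u Iu).
  by move=> i k u Iu; case: (rig i k u Iu).
have qconst p q : x p - N p = x q - N q.
  apply/rowP => m.
  apply: (const (fun p => (x p - N p) 0 m) (fun i u => (X i u - z i u) 0 m)).
  - by move=> i u Iu; rewrite -(NE i u Iu).
  - by move=> i; exact: ((smooth_rowP _ (@img_open _ _ A i)).1 (sq i) m).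
  move=> i k u Iu; have [_ E] := rig i k u Iu; move: E; rewrite pd.unlock => E.
  apply: (etrans (derive_coord m (smooth_derivable (sq i) Iu))).
  by apply: (etrans (congr1 (fun t : 'rV[R]_3 => t 0 m) E)); rewrite mxE.
(* The radius is the length of [N], positive by [w_gt0]. *)
have N0 : 0 < ip (N p0) (N p0).
  have [i pi] := dom_cover A p0; have Iu : img i (chart i p0) by exists p0.
  have := w_gt0 (H i) Iu; rewrite /sq_norm -/(z i _) -(NE i _ Iu).
  by rewrite /in_chart /= chartK.
exists (x p0 - N p0), (Num.sqrt (ip (N p0) (N p0))); split.
  by rewrite sqrtr_gt0.
move=> p; rewrite (qconst p0 p) opprB addrC subrK sqr_sqrtr ?ltW //.
Qed.

Lemma sphere_portion a r : 0 < r ->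
  (forall p, ip (x p - a) (x p - a) = r ^+ 2) -> open_portion_of_sphere x.
Proof.
move=> r0 onS.
have dE (s t : 'rV[R]_3) : dot s t = ip s t by rewrite ip.unlock.
(* The largest open set that meets the sphere only in the image; [sphere_open] shows that it
   contains the image. *)
exists a, r; split=> //; exists (range x `|` ~` round_sphere a r)^°.
  exact: open_interior.
apply/seteqP; split=> [_ [p _ <-]|Z [/interior_subset[//|nS] /nS //]].
split; last by rewrite /round_sphere /= dE.
have [i pi] := dom_cover A p; have Iu : img i (chart i p) by exists p.
have := sphere_open (@img_open _ _ A i) (chart_smooth i) (@chart_imm i) r0
  (fun t _ => onS (param i t)) Iu.
rewrite /in_chart /= chartK //; apply: filterS => Z HZ.
have [ZS|nS] := pselect (round_sphere a r Z); last by right.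
left; move: ZS; rewrite /round_sphere /= dE => /HZ[t It <-].
by exists (param i t).
Qed.

End Surfaces.

Theorem theorem2p4 (R : realType) (M : topologicalType)
  (A : surface_atlas R M)
  (M_hausdorff : hausdorff_space M)
  (M_second_countable : @second_countable M)
  (M_connected : connected [set: M])
  (x : M -> 'rV[R]_3)
  (x_immersion : immersion A x) :
  homothetic A x (laplace_map A x) <-> open_portion_of_sphere x.
Proof.
split=> [hom|[a [r [r0 [W oW xW]]]]].
  have [[p0 _]|noM] := pselect (exists p : M, True).
    have [a [r [r0 onS]]] := sphere_of_homothetic x_immersion M_connected hom p0.
    exact: (sphere_portion x_immersion r0 onS).
  (* An empty [M] is connected; its image is the empty portion of, say, the unit sphere. *)
  exists 0, 1; split=> //; exists set0; first exact: open0.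
  by rewrite set0I; apply/seteqP; split=> // Z [p]; case: noM; exists p.
apply: (homothetic_of_sphere x_immersion (a := a) r0) => p.
have : (W `&` round_sphere a r) (x p) by rewrite -xW; exists p.
by move=> [_]; rewrite /round_sphere /= ip.unlock.
Qed.
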